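(* Let $\mathbb{X}$ be a Polish space, let $c:\mathbb{X}\times\mathbb{X}\to\mathbb{R}\cup\{+\infty\}$ be lower semicontinuous, and assume that there exist a Polish space $\mathcal{Z}$ and a function $\psi:\mathbb{X}\times\mathcal{Z}\to\mathbb{R}\cup\{+\infty\}$, with $\psi(x,\cdot)$ lower semicontinuous for every $x\in\mathbb{X}$, such that $$c(x,y)=\inf_{z\in\mathcal{Z}}\psi(x,z)+\psi(y,z)\qquad\text{for all }x,y\in\mathbb{X}.$$ Then for all $\mu,\nu\in\mathcal{P}(\mathbb{X})$, $$\mathrm{OT}_c(\mu,\nu)=\inf_{\eta\in\mathcal{P}(\mathcal{Z})}\mathrm{OT}_\psi(\mu,\eta)+\mathrm{OT}_\psi(\nu,\eta).$$
   Context: $\mathcal{P}(\cdot)$ denotes Borel probability measures and $\Pi(\cdot,\cdot)$ the set of couplings. For $\mu,\nu\in\mathcal{P}(\mathbb{X})$, $\eta\in\mathcal{P}(\mathcal{Z})$: $\mathrm{OT}_c(\mu,\nu)=\inf_{\pi\in\Pi(\mu,\nu)}\int_{\mathbb{X}\times\mathbb{X}}c\,d\pi$ and $\mathrm{OT}_\psi(\mu,\eta)=\inf_{\pi\in\Pi(\mu,\eta)}\int_{\mathbb{X}\times\mathcal{Z}}\psi(x,z)\,d\pi(x,z)$. The function $\psi$ is Borel measurable and all integrals are assumed well defined in $\mathbb{R}\cup\{+\infty\}$. *)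

(* Defs.v *)
Set Warnings "-notation-overridden,-notation-incompatible-prefix".
From HB Require Import structures.
From mathcomp Require Import all_boot all_order all_algebra.
From mathcomp Require Import all_classical all_reals all_analysis.
From mathcomp Require Import measurable_realfun.

Set Implicit Arguments.
Unset Strict Implicit.
Unset Printing Implicit Defensive.

Import Order.TTheory GRing.Theory Num.Theory.
Import numFieldNormedType.Exports.

Local Open Scope classical_set_scope.
Local Open Scope ring_scope.
Local Open Scope ereal_scope.

Definition separable (T : topologicalType) : Prop :=
  exists2 D : set T, countable D & dense D.

Definition complete_space (T : uniformType) : Prop :=
  forall F : set_system T, ProperFilter F -> cauchy F -> exists x : T, F --> x.

Definition homeomorphic (S T : topologicalType) : Prop :=
  exists (f : S -> T) (g : T -> S),
    [/\ cancel f g, cancel g f, continuous f & continuous g].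

(* The metric is existentially quantified: being Polish is a property of the
   topology alone. *)
Definition polish (R : realType) (T : topologicalType) : Prop :=
  exists M : metricType R,
    [/\ homeomorphic T M, separable M & complete_space M].

Notation Borel T := (g_sigma_algebraType (@open T)).

Section optimal_transport.
Context {d1 d2 : measure_display} {T1 : measurableType d1}
  {T2 : measurableType d2} {R : realType}.
Variables (mu : probability T1 R) (nu : probability T2 R).

(* On Polish spaces, the product of the Borel sigma-algebras, which T1 * T2
   carries, is the Borel sigma-algebra of the product topology. *)
Definition couplings : set (probability (T1 * T2)%type R) :=
  [set pi | (forall A, measurable A -> pushforward pi fst A = mu A) /\
            (forall B, measurable B -> pushforward pi snd B = nu B)].

Definition OT (f : T1 * T2 -> \bar R) : \bar R :=
  ereal_inf [set \int[pi]_p f p | pi in couplings].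

(* A measurable f has a well-defined integral in R `|` {+oo} iff the integral
   of its negative part is finite. *)
Definition OT_well_defined (f : T1 * T2 -> \bar R) : Prop :=
  forall pi, couplings pi -> \int[pi]_p f^\- p < +oo.

End optimal_transport.

(* Main.v *)
Require Import Defs.
From HB Require Import structures.
From mathcomp Require Import all_boot all_order all_algebra.
From mathcomp Require Import all_classical all_reals all_analysis.
From mathcomp Require Import measurable_realfun.
From mathcomp Require Import lra.

(** The two inequalities are two constructions of a joint law of (x, y, z).

    [OT_le_factored]: let pi couple mu with eta and rho couple nu with eta.
    Gluing pi and rho along their common marginal eta gives random variables
    a, b, z on one probability space with (a, z) of law pi and (b, z) of law
    rho.  The law of (a, b) couples mu with nu, and
    c (a, b) <= psi (a, z) + psi (b, z) pointwise, so that
    OT mu nu c <= \int psi dpi + \int psi drho.  Taking infima over pi and rho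
    separately is legitimate only because neither infimum is -oo (a sum
    -oo + +oo would be -oo): if costs of couplings pi_n tended to -oo fast
    enough, the mixture of the pi_n with weights 2^-(n+1) would be a coupling
    for which the negative part of psi has infinite integral ([OT_gtNy]).

    [factored_le_OT]: let pi couple mu with nu and let eps > 0.  Every pair
    (x, y) has an eps-minimizer z of psi (x, z) + psi (y, z).  If z is chosen
    measurably in (x, y), its law eta under pi is a competitor, because the
    laws of (x, z) and (y, z) couple mu and nu with eta and their total cost is
    at most \int c dpi + eps.

    Both arguments are reduced to a real-valued z or x: a Polish space is a
    Borel retract of the real line, with values in [0, 1]
    ([polish_real_retract]).

    - Selection ([measurable_selection]).  A measurable subset B of W * R is
      obtained by the Souslin operation from sets whose sections are closed and
      depend on w through countably many values only.  Truncating the branches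
      of the Souslin scheme level by level, as in the proof that analytic sets
      are capacitable, loses an arbitrarily small part of the projection of B
      and leaves a subset of B that is a decreasing intersection of sets with
      compact sections; the least points of these sections converge to a point
      of B that depends measurably on w.

    - Gluing ([gluing]).  A law on R * Z with second marginal eta is the law of
      (G (z, u), z), where z has law eta, u is uniform on [0, 1] and
      independent of z, and G (z, -) is the quantile function of the
      conditional law given z ([quantile_transform]); the conditional
      distribution function is needed at countably many points only, where it
      is a Radon-Nikodym density.  Two laws with the same second marginal are
      glued by using the same z and two independent uniform variables. *)

Set Implicit Arguments.
Unset Strict Implicit.
Unset Printing Implicit Defensive.

Import Order.TTheory GRing.Theory Num.Theory.
Import numFieldNormedType.Exports.

Local Open Scope classical_set_scope.
Local Open Scope ring_scope.
Local Open Scope ereal_scope.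

(** * Functions glued along a countable measurable partition *)

Section countable_gluing.
Context d (W : measurableType d).

Lemma measurable_preimage_countType (K : countType) (h : W -> K) (S : set K) :
  (forall k, measurable (h @^-1` [set k])) -> measurable (h @^-1` S).
Proof.
move=> mh; rewrite (_ : _ @^-1` _ =
    \bigcup_k (if k \in S then h @^-1` [set k] else set0)).
  by apply: countable_bigcupT_measurable => // k; case: ifP.
apply/seteqP; split => [w Sw|w [k _]].
  by exists (h w) => //; rewrite mem_set.
by case: ifPn => //; rewrite inE => Sk /= ->.
Qed.

Lemma measurable_fun_countable_glue d' (V : measurableType d') (K : countType)
    (h : W -> K) (g : K -> W -> V) :
  (forall k, measurable (h @^-1` [set k])) ->
  (forall k, measurable_fun setT (g k)) ->
  measurable_fun setT (fun w => g (h w) w).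
Proof.
move=> mh mg _ Y mY; rewrite setTI.
rewrite (_ : _ @^-1` Y = \bigcup_k (h @^-1` [set k] `&` (g k @^-1` Y))).
  apply: countable_bigcupT_measurable => // k; apply: measurableI => //.
  by rewrite -[X in measurable X]setTI; exact: mg.
apply/seteqP; split => [w Yw|w [k _ [/= -> //]]].
by exists (h w).
Qed.

Lemma measurable_first_hit (D : nat -> set W) : (forall n, measurable (D n)) ->
  exists2 k : W -> nat, (forall n, measurable (k @^-1` [set n])) &
    forall w n, D n w -> D (k w) w.
Proof.
move=> mD; pose first n w := D n w /\ forall m, (m < n)%N -> ~ D m w.
pose never w := forall m, ~ D m w.
have /choice[k kP] : forall w, exists k, first k w \/ k = 0%N /\ never w.
  move=> w; have [[n Dn]|nD] := pselect (exists n, D n w); last first.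
    by exists 0%N; right; split => // m Dm; apply: nD; exists m.
  have ex : exists n, `[< D n w >] by exists n; exact/asboolP.
  case: (ex_minnP ex) => m /asboolP Dm mmin; exists m; left; split => // i im.
  by move=> /asboolP/mmin; rewrite leqNgt im.
have firstE n : k @^-1` [set n] =
    [set w | first n w] `|` (if n == 0%N then [set w | never w] else set0).
  apply/seteqP; split => w /=.
    by move=> <-; have [?|[-> ?]] := kP w; [left|right].
  move=> [[Dn ltn]|]; last first.
    by case: eqP => // -> nw; have [[/nw]|[]] := kP w.
  have [[Dk ltk]|[_ /(_ _ Dn)//]] := kP w.
  by case: (ltngtP (k w) n) => // [/ltn|/ltk].
exists k => [n|w n Dn]; last by have [[]|[_ /(_ _ Dn)]] := kP w.
rewrite firstE; apply: measurableU; last first.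
  case: ifP => // _; rewrite (_ : [set w | _] = \bigcap_m ~` D m).
    by apply: bigcap_measurableType => m _; exact: measurableC.
  by apply/seteqP; split => w /= h m; [move=> _|]; exact: h.
rewrite (_ : [set w | _] = D n `&` \bigcap_(m < n) ~` D m).
  apply: measurableI => //.
  by apply: bigcap_measurableType => m _; exact: measurableC.
by apply/seteqP; split => w /= [].
Qed.

End countable_gluing.

(** * The Souslin operation *)

Lemma mkseq_cons (A : Type) (f : nat -> A) n :
  mkseq f n.+1 = f 0%N :: mkseq (f \o succn) n.
Proof. by rewrite /mkseq /= -[1%N]addn0 iotaDl -map_comp. Qed.

Section souslin.
Context {T : Type}.
Implicit Types (E : set (set T)) (B : set T) (F : seq nat -> set T).

Definition souslin_op F : set T :=
  [set t | exists s : nat -> nat, forall n, F (mkseq s n) t].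

Definition souslin E : set (set T) :=
  [set B | exists2 F, forall s, E (F s) & B = souslin_op F].

Lemma souslin_self E : E `<=` souslin E.
Proof.
move=> A EA; exists (fun=> A) => //; apply/seteqP; split => [t At|t [_ /(_ 0%N)]//].
by exists id.
Qed.

(** The index of the set in the union is stored at the root of a branch. *)
Lemma souslin_bigcup E (B : nat -> set T) : E setT ->
  (forall i, souslin E (B i)) -> souslin E (\bigcup_i B i).
Proof.
move=> ET /(_ _)/cid2-/all_sig2[F EF BF].
exists (fun s => if s is i :: s' then F i s' else setT); first by case.
apply/seteqP; split => [t [i _]|t [s st]].
  rewrite BF => -[s st]; exists (fun n => if n is n'.+1 then s n' else i).
  by case=> // n; rewrite mkseq_cons; exact: st.
exists (s 0%N) => //; rewrite BF; exists (s \o succn) => n.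
have : (if mkseq s n.+1 is i :: s' then F i s' else setT) t by exact (st n.+1).
by rewrite mkseq_cons.
Qed.

(* [pair] is a bijection from nat * nat onto the positive integers that is
   increasing in its second argument. *)
Let pair i n := (2 ^ i * n.*2.+1)%N.
Let row m := logn 2 m.
Let rank m := (m %/ 2 ^ row m)./2.

Let rowK i n : row (pair i n) = i.
Proof.
rewrite /row /pair lognM ?expn_gt0// pfactorK// lognE/= dvdn2 /=.
by rewrite odd_double addn0.
Qed.

Let rankK i n : rank (pair i n) = n.
Proof. by rewrite /rank rowK /pair mulKn ?expn_gt0//= uphalf_double. Qed.

Let pair_lt i k n : (k < n)%N -> (pair i k < pair i n)%N.
Proof. by move=> kn; rewrite ltn_pmul2l ?expn_gt0// ltnS ltn_double. Qed.

Let pairK m : (0 < m)%N -> pair (row m) (rank m) = m.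
Proof.
move=> m0; rewrite /pair /rank.
have [k ->] : exists k, m = pair (row m) k.
  have dm : (2 ^ row m %| m)%N by rewrite pfactor_dvdn.
  exists (m %/ 2 ^ row m)./2; rewrite /pair.
  have mE : m = (2 ^ row m * (m %/ 2 ^ row m))%N by rewrite mulnC divnK.
  rewrite [LHS]mE; congr muln.
  rewrite -[LHS]odd_double_half; suff -> : odd (m %/ 2 ^ row m) by [].
  rewrite -[odd _]negbK -dvdn2; apply/negP => d2.
  have := dvdn_mul (dvdnn (2 ^ row m)) d2.
  by rewrite -mE -expnSr pfactor_dvdn// ltnn.
by rewrite -/(rank _) rankK rowK.
Qed.

(** Branches of countably many schemes are interleaved along [pair].  Since
    [pair i] is increasing, a prefix of length [pair i n] of the interleaved
    branch contains the prefix of length [n] of the i-th branch, so that every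
    condition of every scheme is eventually read off. *)
Lemma souslin_bigcap E (B : nat -> set T) : E setT ->
  (forall i, souslin E (B i)) -> souslin E (\bigcap_i B i).
Proof.
move=> ET /(_ _)/cid2-/all_sig2[F EF BF].
pose G m s := if (0 < m)%N then
  F (row m) (mkseq (fun k => nth 0%N s (pair (row m) k)) (rank m)) else setT.
have GE i n s :
    G (pair i n) s = F i (mkseq (fun k => nth 0%N s (pair i k)) n).
  by rewrite /G muln_gt0 expn_gt0/= rowK rankK.
exists (fun s => G (size s) s); first by move=> s; rewrite /G; case: ifP.
have mkseq_pair (s : nat -> nat) i n :
    mkseq (fun k => nth 0%N (mkseq s (pair i n)) (pair i k)) n =
    mkseq (fun k => s (pair i k)) n.
  apply/eq_in_map => k; rewrite mem_iota /= => kn.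
  by rewrite nth_mkseq// pair_lt.
apply/seteqP; split => [t Bt|t [s st]].
  have /(_ _)/cid : forall i, exists s, forall n, F i (mkseq s n) t.
    by move=> i; have := Bt i I; rewrite BF.
  move=> /all_sig[s st]; exists (fun m => s (row m) (rank m)) => m.
  rewrite size_mkseq; have [->//|m0] := posnP m.
  rewrite -(pairK m0) GE mkseq_pair.
  rewrite (_ : mkseq _ _ = mkseq (s (row m)) (rank m)) //.
  by apply: eq_map => k; rewrite rowK rankK.
move=> i _; rewrite BF; exists (fun k => s (pair i k)) => n.
by have := st (pair i n); rewrite size_mkseq GE mkseq_pair.
Qed.

(** Souslin sets are in general not closed under complement; the sets that are
    Souslin together with their complement form a sigma-algebra. *)
Lemma sub_sigma_algebra_souslin E (G : set (set T)) : E set0 -> E setT ->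
  (forall A, G A -> souslin E A /\ souslin E (~` A)) ->
  <<s G >> `<=` souslin E.
Proof.
move=> E0 ET GE; pose H := [set A | souslin E A /\ souslin E (~` A)].
suff sub : <<s G >> `<=` H by move=> A /sub[].
apply: smallest_sub => //; split.
- by split; [|rewrite setC0]; exact: souslin_self.
- by move=> A [? ?]; rewrite setTD; split => //; rewrite setCK.
- move=> F HF; split; first by apply: souslin_bigcup => // i; case: (HF i).
  by rewrite setC_bigcup; apply: souslin_bigcap => // i; case: (HF i).
Qed.

End souslin.

Lemma dependent_choice_seq (A : Type) (Q : seq A -> Prop) :
  Q [::] -> (forall s, Q s -> exists a, Q (rcons s a)) ->
  exists f : nat -> A, forall n, Q (mkseq f n).
Proof.
move=> Q0 QS; have [a0 _] := QS _ Q0.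
have /choice[g gP] : forall s, exists a, Q s -> Q (rcons s a).
  by move=> s; have [/QS[a Qa]|nQ] := pselect (Q s); [exists a|exists a0].
pose L k := iter k (fun s => rcons s (g s)) [::].
exists (g \o L) => n.
suff -> : mkseq (g \o L) n = L n by elim: n => //= n; exact: gP.
by elim: n => // n IH; rewrite mkseqS IH.
Qed.

(** * Branches of a Souslin scheme under a bound *)

Section boxed_branches.
Context {T : Type}.
Implicit Types (F : seq nat -> set T) (f : nat -> nat).

(** Branches are constrained on the levels below [size l] and free above. *)
Definition bounded_branch F (l : seq nat) : set T :=
  [set t | exists2 s : nat -> nat,
    (forall i, (i < size l)%N -> (s i <= nth 0%N l i)%N) &
    forall n, F (mkseq s n) t].

Lemma bounded_branch_nil F : bounded_branch F [::] = souslin_op F.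
Proof. by apply/seteqP; split => t [s]; [move=> _|]; exists s. Qed.

Lemma bounded_branch_rcons F l :
  bounded_branch F l = \bigcup_n bounded_branch F (rcons l n).
Proof.
apply/seteqP; split => t.
  move=> [s sl Ft]; exists (s (size l)) => //; exists s => // i.
  by rewrite size_rcons ltnS leq_eqVlt nth_rcons => /predU1P[->|il];
    rewrite ?ltnn ?eqxx// il sl.
move=> [n _ [s sl Ft]]; exists s => // i il.
by have := sl i; rewrite size_rcons nth_rcons il; apply; exact: ltnW.
Qed.

Lemma bounded_branch_rcons_homo F l m n : (m <= n)%N ->
  bounded_branch F (rcons l m) `<=` bounded_branch F (rcons l n).
Proof.
move=> mn t [s sl Ft]; exists s => // i; rewrite size_rcons => il.
have := sl i; rewrite size_rcons => /(_ il); rewrite !nth_rcons.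
by case: ifP => // _; case: ifP => // _ /leq_trans; exact.
Qed.

(** What finitely many levels can see of the branches bounded by [f]: a finite
    union of finite intersections of sets of the scheme. *)
Fixpoint subtree F f k (s : seq nat) : set T :=
  F s `&` if k is k'.+1
    then \bigcup_(i < (f (size s)).+1) subtree F f k' (rcons s i) else setT.

Lemma subtreeS F f k s : subtree F f k.+1 s `<=` subtree F f k s.
Proof.
elim: k s => [s t [Ft _]//|k IH s t [Ft [i fi /IH ti]]].
by split => //; exists i.
Qed.

Lemma subtree_homo F f s m n : (m <= n)%N ->
  subtree F f n s `<=` subtree F f m s.
Proof.
move=> /subnK <-; elim: (n - m)%N => // k IH t /subtreeS; exact: IH.
Qed.

Lemma subtree_root F f k s : subtree F f k s `<=` F s.
Proof. by case: k => [|k] t []. Qed.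

(** Koenig's lemma: the tree of the finite sequences bounded by [f] along which
    [t] survives is infinite and finitely branching, hence has an infinite
    branch. *)
Lemma subtree_koenig F f t : (forall k, subtree F f k [::] t) ->
  souslin_op F t.
Proof.
move=> Ft; have [] := @dependent_choice_seq nat
    (fun s => forall k, subtree F f k s t) Ft; last first.
  by move=> s st; exists s => n; exact: subtree_root (st n 0%N).
move=> s st; apply: contrapT => /forallNP; rewrite /= => nst.
have /choice[K KP] : forall i, exists k, ~ subtree F f k (rcons s i) t.
  by move=> i; exact/existsNP/nst.
pose M := (\max_(i < (f (size s)).+1) K i)%N.
have [_ [i fi ti]] := st M.+1; apply: (KP i).
by apply: subtree_homo ti; exact: (@leq_bigmax _ _ (Ordinal fi)).
Qed.

Lemma branch_subtree F f (s : nat -> nat) k n t :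
  (forall i, (i < n + k)%N -> (s i <= f i)%N) ->
  (forall n, F (mkseq s n) t) -> subtree F f k (mkseq s n) t.
Proof.
move=> sf Ft; elim: k n sf => [|k IH] n sf; first by split.
split => //; exists (s n); first by rewrite /= size_mkseq ltnS sf// addnS ltnS leq_addr.
by rewrite -mkseqS; apply: IH => i; rewrite addSnnS; exact: sf.
Qed.

Lemma bounded_branch_sub_subtree F f k :
  bounded_branch F (mkseq f k) `<=` subtree F f k [::].
Proof.
move=> t [s sf Ft]; apply: (@branch_subtree _ _ s k 0%N) => // i ik.
by have := sf i; rewrite size_mkseq nth_mkseq//; exact.
Qed.

End boxed_branches.

(** * Sets with closed sections that take countably many values *)

Section countably_many_closed_sections.
Context d (W : measurableType d) (R : realType).
Implicit Types E : set (W * R).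

(** As the section at [w] depends on [w] through a countable-valued measurable
    function, every function of the section is measurable in [w], be it a
    projection or an infimum; and this property survives finite unions and
    intersections. *)
Definition countable_closed_sections : set (set (W * R)) :=
  [set E | exists (K : countType) (h : W -> K) (I : K -> set R),
    [/\ forall k, measurable (h @^-1` [set k]), forall k, closed (I k) &
        E = [set p | I (h p.1) p.2]]].

Lemma countable_closed_sections_cyl (A : set W) (C : set R) :
  measurable A -> closed C -> countable_closed_sections (A `*` C).
Proof.
move=> mA cC; exists bool, (fun w => w \in A), (fun b => if b then C else set0).
split => [b|[] //|]; [|exact: closed0|]; last first.
  apply/seteqP; split => -[w t] /=; first by case=> wA tC; rewrite mem_set.
  by case: ifPn => //; rewrite inE.
rewrite (_ : _ @^-1` _ = if b then A else ~` A).
  by case: b => //; exact: measurableC.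
apply/seteqP; split => w /=; case: b => /=.
- by move/set_mem.
- by move=> /negbT; rewrite notin_setE.
- by move/mem_set.
- by move=> wA; apply/negbTE; rewrite notin_setE.
Qed.

Lemma countable_closed_sectionsT : countable_closed_sections setT.
Proof. by rewrite -setXTT; exact: countable_closed_sections_cyl. Qed.

Lemma countable_closed_sections0 : countable_closed_sections set0.
Proof. by rewrite -(@set0X _ _ setT); exact: countable_closed_sections_cyl. Qed.

Lemma countable_closed_sectionsI E E' : countable_closed_sections E ->
  countable_closed_sections E' -> countable_closed_sections (E `&` E').
Proof.
move=> [K [h [I [mh cI ->]]]] [K' [h' [I' [mh' cI' ->]]]].
exists (K * K')%type, (fun w => (h w, h' w)), (fun k => I k.1 `&` I' k.2).
split => // [[k k']|k]; last exact: closedI.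
rewrite (_ : _ @^-1` _ = h @^-1` [set k] `&` h' @^-1` [set k']).
  exact: measurableI.
by apply/seteqP; split => w /=; [case|case=> -> ->].
Qed.

Lemma countable_closed_sectionsU E E' : countable_closed_sections E ->
  countable_closed_sections E' -> countable_closed_sections (E `|` E').
Proof.
move=> [K [h [I [mh cI ->]]]] [K' [h' [I' [mh' cI' ->]]]].
exists (K * K')%type, (fun w => (h w, h' w)), (fun k => I k.1 `|` I' k.2).
split => // [[k k']|k]; last exact: closedU.
rewrite (_ : _ @^-1` _ = h @^-1` [set k] `&` h' @^-1` [set k']).
  exact: measurableI.
by apply/seteqP; split => w /=; [case|case=> -> ->].
Qed.

Lemma countable_closed_sections_subtree F f k s :
  (forall s, countable_closed_sections (F s)) ->
  countable_closed_sections (subtree F f k s).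
Proof.
move=> FE; elim: k s => [|k IH] s; apply: countable_closed_sectionsI => //.
  exact: countable_closed_sectionsT.
rewrite bigcup_mkord; elim/big_ind : _ => //.
- exact: countable_closed_sections0.
- exact: countable_closed_sectionsU.
Qed.

(** An open half-line is a countable union of closed ones, hence cylinders over
    open half-lines are Souslin, and their complements are closed. *)
Lemma measurable_souslin (B : set (W * R)) : measurable B ->
  souslin countable_closed_sections B.
Proof.
move=> mB; pose G : set (set (W * R)) :=
  [set A `*` setT | A in measurable] `|` [set setT `*` `]x, +oo[%classic | x in setT].
apply: (@sub_sigma_algebra_souslin _ _ G).
- exact: countable_closed_sections0.
- exact: countable_closed_sectionsT.
- move=> _ [[A mA <-]|[x _ <-]].
    split; first exact/souslin_self/countable_closed_sections_cyl.
    rewrite setXT preimage_setC -setXT.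
    apply/souslin_self/countable_closed_sections_cyl => //.
    exact: measurableC.
  split; last first.
    rewrite setTX preimage_setC -setTX setCitvr.
    exact/souslin_self/countable_closed_sections_cyl.
  rewrite itvoyEbigcup setTX preimage_bigcup.
  apply: souslin_bigcup => [|n]; first exact: countable_closed_sectionsT.
  rewrite -setTX; apply/souslin_self/countable_closed_sections_cyl => //.
  by rewrite set_itvE; exact: closed_ge.
- pose T := g_sigma_algebraType G.
  suff sub : @measurable _ (W * R)%type `<=` <<s G >> by exact: sub.
  apply: smallest_sub; first exact: smallest_sigma_algebra.
  rewrite subUset; split => _ [A mA <-].
    rewrite setTI -setXT; apply: sub_sigma_algebra; left; by exists A.
  suff msnd : @measurable_fun _ _ T R setT snd by exact: msnd.
  apply: (measurability (@RGenOInfty.G R)); first exact: RGenOInfty.measurableE.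
  move=> _ [_ [x ->] <-]; rewrite setTI -setTX.
  by apply: sub_sigma_algebra; right; exists x.
Qed.

Lemma measurable_section_inf E (S : set R) : countable_closed_sections E ->
  measurable_fun setT (fun w => inf [set t | S t /\ E (w, t)]).
Proof.
move=> [K [h [I [mh cI ->]]]] _ Y mY; rewrite setTI.
rewrite (_ : _ @^-1` _ = h @^-1` [set k | Y (inf [set t | S t /\ I k t])])//.
exact: measurable_preimage_countType.
Qed.

Lemma measurable_section_neq0 E (S : set R) : countable_closed_sections E ->
  measurable [set w | exists2 t, S t & E (w, t)].
Proof.
move=> [K [h [I [mh cI ->]]]].
rewrite [X in measurable X](_ : _ = h @^-1` [set k | exists2 t, S t & I k t])//.
exact: measurable_preimage_countType.
Qed.

End countably_many_closed_sections.

(** * Measurable selection *)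

Lemma closed_inf (R : realType) (A : set R) : closed A -> has_inf A ->
  A (inf A).
Proof.
move=> cA iA; apply: cA => B /nbhs_ballP[e /= e0 eB].
have [x Ax xe] := inf_adherent e0 iA; exists x; split => //; apply: eB.
have infx : (inf A <= x)%R by apply: ge_inf => //; case: iA.
by rewrite /ball /= distrC ger0_norm ?subr_ge0// ltrBlDl.
Qed.

Lemma nested_closed_sup_inf (R : realType) (C : nat -> set R) (a b : R) :
  (forall n, closed (C n)) -> (forall n, C n `<=` `[a, b]%classic) ->
  (forall n, C n !=set0) -> {homo C : m n / (m <= n)%N >-> n `<=` m} ->
  (fun n => inf (C n)) @ \oo --> sup (range (fun n => inf (C n))) /\
  forall n, C n (sup (range (fun n => inf (C n)))).
Proof.
move=> cC Cab C0 Cdec.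
have iC n : has_inf (C n).
  by split => //; exists a => x /Cab; rewrite /= in_itv /= => /andP[].
have cvgC : (fun n => inf (C n)) @ \oo --> sup (range (fun n => inf (C n))).
  apply: nondecreasing_cvgn.
    move=> m n mn; apply: lb_le_inf => // x /(Cdec _ _ mn) Cx.
    by apply: ge_inf => //; case: (iC m).
  exists b => _ [n _ <-]; have := Cab n _ (closed_inf (cC n) (iC n)).
  by rewrite /= in_itv /= => /andP[].
split => // n; apply: (closed_cvg _ (cC n)) cvgC.
near=> m; apply: (Cdec n m); last exact: closed_inf.
by near: m; exact: nbhs_infty_ge.
Unshelve. all: by end_near. Qed.

Section measurable_selection.
Context d (W : measurableType d) (R : realType) (P : probability W R).

(** The outer measure of [S] exceeds [a] (the infimum that defines the outer
    measure of a finite measure is attained). *)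
Definition outer_gt (a : \bar R) (S : set W) : Prop :=
  forall A, measurable A -> S `<=` A -> a < P A.

(** Continuity from below of the outer measure: measurable covers [A n] of the
    [S n] can be replaced by the increasing covers given by the intersections of
    the tails. *)
Lemma outer_gt_bigcup a (S : nat -> set W) :
  {homo S : m n / (m <= n)%N >-> m `<=` n} ->
  outer_gt a (\bigcup_n S n) -> exists n, outer_gt a (S n).
Proof.
move=> Smon Sa; apply: contrapT => /forallNP nS.
have /choice[A AP] : forall n, exists A, [/\ measurable A, S n `<=` A & P A <= a].
  move=> n; have /existsNP[A /not_implyP[mA /not_implyP[SA /negP]]] := nS n.
  by rewrite -leNgt => PA; exists A.
pose A' n := \bigcap_(m in [set m | (n <= m)%N]) A m.
have mA' n : measurable (A' n).
  by apply: bigcap_measurableType => m _; case: (AP m).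
have mU : measurable (\bigcup_n A' n) by exact: bigcupT_measurable.
have : a < P (\bigcup_n A' n).
  apply: Sa => // w [n _ Sw]; exists n => // m /= nm.
  by have [_ + _] := AP m; apply; exact: Smon Sw.
have A'mon : nondecreasing_seq A'.
  move=> m n mn; apply/subsetPset => w A'w k /= nk; apply: A'w => /=.
  exact: leq_trans nk.
have cvgA' := @nondecreasing_cvg_mu _ _ _ P _ mA' mU A'mon.
rewrite -(cvg_lim _ cvgA')//.
apply/negP; rewrite -leNgt; apply: lime_le.
  by apply/cvg_ex; exists (P (\bigcup_n A' n)).
apply: nearW => n; have [mA _] := AP n; apply: le_trans.
by rewrite le_measure ?inE// => w; apply => /=.
Qed.

(** Capacitability of Souslin sets: bounds are put on the branches one level
    after the other, keeping the outer measure of the projection above [p]. The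
    finite-level approximations then decrease to a subset of [B] with compact
    sections, and their least points increase to a point of this subset. *)
Lemma partial_selection (B : set (W * R)) (a b : R) (p : \bar R) :
  measurable B -> (forall w, exists2 t, `[a, b]%classic t & B (w, t)) ->
  p < 1 ->
  exists (D : set W) (z : W -> R), [/\ measurable D, measurable_fun setT z,
    p <= P D & forall w, D w -> B (w, z w)].
Proof.
move=> mB Bab p1; have [F Fcl BF] := measurable_souslin mB.
pose pr (E : set (W * R)) := [set w | exists2 t, `[a, b]%classic t & E (w, t)].
have prS E E' : E `<=` E' -> pr E `<=` pr E'.
  by move=> EE' w [t abt /EE' ?]; exists t.
have [|l lp|f fP] := @dependent_choice_seq nat
    (fun l => outer_gt p (pr (bounded_branch F l))).
- move=> A mA BA; rewrite (_ : A = setT) ?probability_setT//.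
  by apply/seteqP; split => // w _; apply: BA; rewrite bounded_branch_nil -BF.
- apply: outer_gt_bigcup.
    by move=> m n mn; exact/prS/bounded_branch_rcons_homo.
  rewrite (_ : \bigcup_n _ = pr (bounded_branch F l)) // bounded_branch_rcons.
  apply/seteqP; split => w; first by move=> [n _ [t abt Bt]]; exists t => //; exists n.
  by move=> [t abt [n _ Bt]]; exists n => //; exists t.
pose C k := subtree F f k [::].
have Ccl k : countable_closed_sections (C k).
  exact: countable_closed_sections_subtree.
pose D := \bigcap_k pr (C k).
have mD : measurable D.
  by apply: bigcap_measurableType => k _; exact: measurable_section_neq0.
pose S w k := [set t | `[a, b]%classic t /\ C k (w, t)].
have SP w : D w ->
    (fun k => inf (S w k)) @ \oo --> sup (range (fun k => inf (S w k))) /\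
    forall k, S w k (sup (range (fun k => inf (S w k)))).
  move=> Dw; apply: (@nested_closed_sup_inf _ _ a b).
  - move=> k; apply: closedI; first exact: interval_closed.
    have [K [h [I [_ cI CE]]]] := Ccl k; rewrite CE; exact (cI (h w)).
  - by move=> k t [].
  - by move=> k; have [t abt Ct] := Dw k I; exists t.
  - by move=> m n mn t [abt Ct]; split => //; exact: subtree_homo Ct.
exists D, ((fun w => sup (range (fun k => inf (S w k)))) \_ D); split => //.
- apply: (measurable_restrictT _ mD).1.
  apply: (@measurable_fun_cvg _ _ _ _ (fun k w => inf (S w k))).
    move=> k; apply: measurable_funTS; exact: measurable_section_inf.
  by move=> w Dw; have [] := SP w Dw.
- have prCmon : nonincreasing_seq (fun k => pr (C k)).
    move=> m n mn; apply/subsetPset/prS => q; exact: subtree_homo.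
  have mprC k : measurable (pr (C k)) by exact: measurable_section_neq0.
  have cvgC := @nonincreasing_cvg_mu _ _ _ P _ _ mprC mD prCmon.
  rewrite -(cvg_lim _ (cvgC _))//; last first.
    by rewrite (le_lt_trans (probability_le1 _ _))// ltry.
  apply: lime_ge.
    apply/cvg_ex; exists (P D); apply: cvgC.
    by rewrite (le_lt_trans (probability_le1 _ _))// ltry.
  apply: nearW => k; apply/ltW/(fP k) => //.
  by apply: prS; exact: bounded_branch_sub_subtree.
- move=> w Dw; rewrite patchE mem_set// BF; apply: (@subtree_koenig _ _ f) => k.
  by have [_ /(_ k)[]] := SP w Dw.
Qed.

(** The theorem of Jankov and von Neumann, modulo a null set: partial selections
    on sets of measure close to 1 are glued. *)
Lemma measurable_selection (B : set (W * R)) (a b : R) :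
  measurable B -> (forall w, exists2 t, `[a, b]%classic t & B (w, t)) ->
  exists2 z : W -> R, measurable_fun setT z &
    {ae P, forall w, B (w, z w)}.
Proof.
move=> mB Bab.
have /choice[D /choice[z Dz]] : forall n, exists (D : set W) (z : W -> R),
    [/\ measurable D, measurable_fun setT z,
        (1 - n.+1%:R^-1)%:E <= P D & forall w, D w -> B (w, z w)].
  move=> n; apply: (partial_selection mB Bab).
  by rewrite lte_fin ltrBlDr ltrDl invr_gt0.
have [k mk kP] := @measurable_first_hit _ W D (fun n => let: And4 h _ _ _ := Dz n in h).
exists (fun w => z (k w) w).
  by apply: measurable_fun_countable_glue => // n; case: (Dz n).
exists (~` \bigcup_n D n); split.
- by apply/measurableC/bigcupT_measurable => n; case: (Dz n).
- have mU : measurable (\bigcup_n D n).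
    by apply: bigcupT_measurable => n; case: (Dz n).
  rewrite probability_setC// (_ : P _ = 1) ?subee//.
  apply/eqP; rewrite eq_le probability_le1//=.
  apply/lee_addgt0Pr => e e0.
  have [n _ /(_ n (leqnn n)) /= ne] := near_infty_natSinv_lt (PosNum e0).
  have -> : 1 = (1 - n.+1%:R^-1)%:E + (n.+1%:R^-1)%:E :> \bar R.
    by rewrite -EFinD subrK.
  apply: leeD; last by rewrite lee_fin ltW.
  have [mD _ + _] := Dz n; move/le_trans; apply.
  by rewrite le_measure ?inE// => w Dw; exists n.
- move=> w nB [n _ Dn]; apply: nB.
  by have [_ _ _] := Dz (k w); apply; exact: kP Dn.
Qed.

End measurable_selection.

(** * Polish spaces as Borel retracts of the real line *)

Section ternary_code.
Context {R : realType}.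
Implicit Types (b : nat -> bool) (t : R).

(** Digits 0 and 1 in base 3: the digits after any position weigh at most half a
    unit of that position, so that they can be recovered without ambiguity,
    unlike in base 2. *)
Fixpoint ternary_sum b n : R :=
  if n is m.+1
  then (((if b 0%N then 1 else 0) + ternary_sum (b \o succn) m) / 3)%R else 0%R.

Definition ternary b : R := sup (range (ternary_sum b)).

Lemma ternary_sum_bound b n : (0 <= ternary_sum b n <= 2^-1)%R.
Proof.
elim: n b => [|n IH] b /=; first by rewrite lexx invr_ge0 ler0n.
have /andP[h0 h1] := IH (b \o succn).
by case: (b 0%N) => /=; apply/andP; split; lra.
Qed.

Lemma ternary_sum_nondecreasing b : nondecreasing_seq (ternary_sum b).
Proof.
apply/nondecreasing_seqP => n; elim: n b => [|n IH] b /=.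
  by case: (b 0%N) => /=; lra.
by have /= := IH (b \o succn); lra.
Qed.

Lemma cvg_ternary b : ternary_sum b @ \oo --> ternary b.
Proof.
apply: nondecreasing_cvgn; first exact: ternary_sum_nondecreasing.
by exists (2^-1)%R => _ [n _ <-]; have /andP[] := ternary_sum_bound b n.
Qed.

Lemma ternary_bound b : (0 <= ternary b <= 2^-1)%R.
Proof.
have cb : cvgn (ternary_sum b) by apply/cvg_ex; eexists; exact: cvg_ternary.
rewrite -(cvg_lim _ (cvg_ternary (b := b)))//; apply/andP; split.
  by apply: limr_ge => //; apply: nearW => n; have /andP[] := ternary_sum_bound b n.
by apply: limr_le => //; apply: nearW => n; have /andP[] := ternary_sum_bound b n.
Qed.

Lemma ternaryS b :
  ternary b = (((if b 0%N then 1 else 0) + ternary (b \o succn)) / 3)%R.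
Proof.
have := @cvg_ternary b; rewrite -cvg_shiftS => /cvg_unique; apply => //.
apply: cvgMl; apply: cvgD; first exact: cvg_cst.
exact: cvg_ternary.
Qed.

Definition ternary_tail t : R := (if 3^-1 <= t then 3 * t - 1 else 3 * t)%R.

Definition ternary_digit i t : bool := (3^-1 <= iter i ternary_tail t)%R.

Lemma ternary_head b : (3^-1 <= ternary b)%R = b 0%N.
Proof.
rewrite ternaryS; have /andP[h0 h1] := ternary_bound (b \o succn).
by case: (b 0%N) => /=; [apply/idP|apply/negbTE; rewrite -ltNge]; lra.
Qed.

Lemma ternary_tailK b : ternary_tail (ternary b) = ternary (b \o succn).
Proof.
rewrite /ternary_tail ternary_head; rewrite (ternaryS b).
by case: (b 0%N) => /=; lra.
Qed.

Lemma ternary_digitK b i : ternary_digit i (ternary b) = b i.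
Proof.
rewrite /ternary_digit; elim: i b => [|i IH] b; first exact: ternary_head.
by rewrite iterSr ternary_tailK IH.
Qed.

Lemma measurable_ternary_tail : measurable_fun setT ternary_tail.
Proof.
apply: measurable_fun_ifT; first exact: measurable_fun_ler.
  by apply: measurable_funB => //; exact: mulrl_measurable.
exact: mulrl_measurable.
Qed.

Lemma measurable_ternary_digit i : measurable_fun setT (ternary_digit i).
Proof.
apply: measurable_fun_ler => //; elim: i => [|i IH] /=; first exact: measurable_id.
exact: (measurableT_comp measurable_ternary_tail).
Qed.

Lemma measurable_ternary d (T : measurableType d) (b : T -> nat -> bool) :
  (forall i, measurable_fun setT (b ^~ i)) ->
  measurable_fun setT (fun x => ternary (b x)).
Proof.
move=> mb; apply: (@measurable_fun_cvg _ _ _ _ (fun n x => ternary_sum (b x) n)).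
  move=> n; elim: n b mb => [|n IH] b mb /=; first exact: measurable_cst.
  apply: measurable_funM; last exact: measurable_cst.
  apply: measurable_funD; last by apply: (IH (fun x => b x \o succn)) => i; exact: mb.
  exact: measurable_fun_ifT.
by move=> x _; exact: cvg_ternary.
Qed.

End ternary_code.

Section dense_sequence.
Context {R : realType} {M : metricType R}.

Lemma metric_ball_open (x : M) (r : R) : open (ball x r).
Proof.
rewrite openE => y /=; rewrite ballEmdist /= => xy.
apply/nbhs_ballP; exists (r - mdist x y)%R => /=; first by rewrite subr_gt0.
move=> z; rewrite !ballEmdist /= ltrBrDl; apply: le_lt_trans.
exact: metric_triangle.
Qed.

Lemma dense_seq (x0 : M) : separable M ->
  exists q : nat -> M, forall (x : M) (e : R), (0 < e)%R -> exists n, ball (q n) e x.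
Proof.
move=> [D /countable_injP[g ginj] dD].
exists (fun n => xget x0 [set y | D y /\ g y = n]) => x e e0.
have [|y [xy Dy]] := dD (ball x e) _ (metric_ball_open x e).
  by exists x; exact: ballxx.
exists (g y); set z := xget _ _.
have [Dz gzy] : D z /\ g z = g y.
  exact: (@xgetPex _ x0 [set z | D z /\ g z = g y] (ex_intro _ y (conj Dy erefl))).
by rewrite (ginj z y) ?inE//; exact: ball_sym.
Qed.

End dense_sequence.

Section polish_space.
Context {R : realType} (X : ptopologicalType).

Let radius n : R := (n.+1%:R^-1)%R.

Let radius_gt0 n : (0 < radius n)%R.
Proof. by rewrite invr_gt0. Qed.

Let radius_small (e : R) : (0 < e)%R -> exists n, (radius n < e)%R.
Proof.
move=> e0; have [n _ /(_ n (leqnn n)) /= ne] := near_infty_natSinv_lt (PosNum e0).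
by exists n.
Qed.

Lemma polish_second_countable : polish R X -> exists V : nat -> set X,
  (forall n, open (V n)) /\
  forall U x, open U -> U x -> exists n, V n x /\ V n `<=` U.
Proof.
move=> [M [[f [g [fK gK cf cg]]] sM _]].
have [q qP] := dense_seq (f point) sM.
pose ball_ (p : nat * nat) := f @^-1` ball (q p.1) (radius p.2).
exists (fun n => if unpickle n is Some p then ball_ p else set0); split.
  move=> n; case: unpickle => [p|]; last exact: open0.
  by move/continuousP: cf; apply; exact: metric_ball_open.
move=> U x oU Ux; have : nbhs (f x) (g @^-1` U).
  apply: open_nbhs_nbhs; split; last by rewrite /= fK.
  by move/continuousP: cg; exact.
move=> /nbhs_ballP[e /= e0 eU].
have [n ne] : exists n, (radius n < e / 2)%R by apply: radius_small; rewrite divr_gt0.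
have [j qj] := qP (f x) _ (radius_gt0 n).
exists (pickle (j, n)); rewrite pickleK; split => // y /= qy.
rewrite -[y]fK; apply: eU; apply: (@le_ball _ _ _ (radius n + radius n)); first lra.
by apply: ball_triangle qy; exact: ball_sym.
Qed.

(** A point is encoded by the indices [k n x] of the first points of a dense
    sequence [q] that approximate it within [radius n], and these indices by the
    digits of a real number. Decoding reads indices [h n t] off the digits of
    [t] and takes the limit of [q (h n t)] when this sequence is Cauchy with the
    expected rate, a condition on countably many indices, hence a Borel one. *)
Theorem polish_real_retract : polish R X ->
  exists (e : Borel X -> R) (r : R -> Borel X), [/\ measurable_fun setT e,
    measurable_fun setT r, (forall x, 0 <= e x <= 1)%R & cancel e r].
Proof.
move=> [M [[f [g [fK gK cf cg]]] sM complM]].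
have [q qP] := dense_seq (f point) sM.
have mball j r : measurable (f @^-1` ball (q j) r : set (Borel X)).
  apply: sub_sigma_algebra; move/continuousP: cf; apply; exact: metric_ball_open.
have /(@choice nat (Borel X -> nat))[k kP] : forall n, exists k : Borel X -> nat,
    (forall j, measurable (k @^-1` [set j])) /\
    forall x, ball (q (k x)) (radius n) (f x).
  move=> n; have [k mk kP] := @measurable_first_hit _ (Borel X)
    (fun j => f @^-1` ball (q j) (radius n)) (mball ^~ (radius n)).
  exists k; split => // x; have [j qj] := qP (f x) _ (radius_gt0 n).
  exact: kP qj.
pose bits (x : Borel X) i := if unpickle i is Some (n, j) then k n x == j else false.
have mbits i : measurable_fun setT (bits ^~ i).
  rewrite /bits; case: unpickle => [[n j]|]; last exact: measurable_cst.
  apply: (@measurable_fun_bool _ _ _ _ true); rewrite setTI.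
  rewrite (_ : _ @^-1` _ = k n @^-1` [set j]); first by case: (kP n).
  by apply/seteqP; split => x /= /eqP.
pose e x : R := ternary (bits x).
have /(@choice nat (R -> nat))[h hP] : forall n : nat, exists h : R -> nat,
    (forall j, measurable (h @^-1` [set j])) /\
    forall (t : R) (j : nat), ternary_digit (pickle (n, j)) t ->
      ternary_digit (pickle (n, h t)) t.
  move=> n; have [|h mh hP] := @measurable_first_hit _ R
    (fun j => [set t | ternary_digit (pickle (n, j)) t]); last by exists h.
  move=> j; rewrite -[X in measurable X]setTI.
  by have := @measurable_ternary_digit R (pickle (n, j)) measurableT [set true]; exact.
have he n x : h n (e x) = k n x.
  have : ternary_digit (pickle (n, k n x)) (e x).
    by rewrite ternary_digitK /bits pickleK.
  by move=> /(hP n).2; rewrite ternary_digitK /bits pickleK => /eqP.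
(* The codes that decode to a Cauchy sequence with the rate enjoyed by the codes
   of points. *)
pose C := \bigcap_n \bigcap_m [set t | (n <= m)%N ->
  ball (q (h n t)) (radius n + radius n) (q (h m t))].
have mC : measurable C.
  apply: bigcap_measurableType => n _; apply: bigcap_measurableType => m _.
  pose hnm t := (h n t, h m t).
  rewrite [X in measurable X](_ : _ = hnm @^-1` [set p | (n <= m)%N ->
    ball (q p.1) (radius n + radius n) (q p.2)])//.
  apply: measurable_preimage_countType => -[i j].
  rewrite (_ : _ @^-1` _ = (h n @^-1` [set i]) `&` (h m @^-1` [set j])).
    by apply: measurableI; [case: (hP n)|case: (hP m)].
  by apply/seteqP; split => t; rewrite /hnm /=; [case|case=> -> ->].
have radiusS n m : (n <= m)%N -> (radius m <= radius n)%R.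
  by move=> nm; rewrite lef_pV2 ?posrE// ler_nat ltnS.
have eC x : C (e x).
  move=> n _ m _ nm /=; rewrite !he; apply: (ball_triangle ((kP n).2 x)).
  apply: ball_sym; apply: (le_ball (radiusS _ _ nm)); exact: (kP m).2.
have /(@choice R M)[y yP] : forall t, exists y : M,
    (C t -> forall n, ball (q (h n t)) (radius n + radius n + radius n) y) /\
    (~ C t -> y = f point).
  move=> t; have [Ct|nCt] := pselect (C t); last by exists (f point).
  have [y yP] : exists y : M, (fun n => q (h n t)) @ \oo --> y.
    apply: complM; apply/cauchy_ballP => d d0.
    have [n nd] : exists n, (radius n < d / 4)%R.
      by apply: radius_small; rewrite divr_gt0.
  near_simpl.
    near=> i j => /=.
    apply: (@le_ball _ _ _ ((radius n + radius n) + (radius n + radius n))%R).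
      lra.
    apply: (@ball_triangle _ _ (q (h n t))); [apply: ball_sym|].
      by apply: (Ct n I i I); near: i; exact: nbhs_infty_ge.
    by apply: (Ct n I j I); near: j; exact: nbhs_infty_ge.
  exists y; split => // _ n.
  have [m [nm ym]] : exists m, (n <= m)%N /\ ball y (radius n) (q (h m t)).
    have := yP _ (nbhsx_ballx y _ (radius_gt0 n)).
    move=> [m _ mP]; exists (maxn n m); split; first exact: leq_maxl.
    exact: (mP (maxn n m) (leq_maxr _ _)).
  exact: ball_triangle (Ct n I m I nm) (ball_sym ym).
exists e, (g \o y); split.
- exact: measurable_ternary.
- apply: (@measurability _ _ R (Borel X) _ _ (@open X)) => // _ [U oU <-].
  have oV : open (g @^-1` U) by move/continuousP: cg; exact.
  rewrite setTI.
  have -> : (g \o y) @^-1` U = (C `&` \bigcup_n h n @^-1`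
      [set i | ball (q i) (radius n + radius n + radius n) `<=` g @^-1` U]) `|`
      (~` C `&` if `[< U (g (f point)) >] then setT else set0).
    apply/seteqP; split => t /=.
      move=> Uy; have [Ct|nCt] := pselect (C t); last first.
        by right; split => //; case: asboolP => //; rewrite -(yP t).2.
      left; split => //; have : nbhs (y t) (g @^-1` U) by exact: open_nbhs_nbhs.
      move=> /nbhs_ballP[d /= d0 dU].
      have [n nd] : exists n, (radius n < d / 6)%R.
        by apply: radius_small; rewrite divr_gt0.
      exists n => //= z qz; apply: dU.
      have := ball_triangle (ball_sym ((yP t).1 Ct n)) qz.
      by apply: le_ball; lra.
    move=> [[Ct [n _]]|[nCt]]; first by apply; exact: (yP t).1.
    by case: asboolP => // Up _; rewrite (yP t).2.
  apply: measurableU.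
    apply: measurableI => //; apply: bigcupT_measurable => n.
    by apply: measurable_preimage_countType; case: (hP n).
  by apply: measurableI; [exact: measurableC|case: ifP].
- move=> x; have /andP[-> ?] := @ternary_bound R (bits x).
  by rewrite /e /=; lra.
- move=> x /=; rewrite -[RHS]fK; congr g; apply: mdist_positivity.
  apply/eqP; rewrite eq_le mdist_ge0 andbT leNgt; apply/negP => d0.
  have [n nd] : exists n, (radius n < mdist (y (e x)) (f x) / 4)%R.
    by apply: radius_small; rewrite divr_gt0.
  have := ball_triangle (ball_sym ((yP (e x)).1 (eC x) n)) _.
  rewrite he => /(_ _ _ ((kP n).2 x)); rewrite ballEmdist /= => lt_d.
  lra.
Unshelve. all: by end_near. Qed.

End polish_space.

(** * Laws on a product as images of a uniform noise *)

Section conditional_probability.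
Context d1 d2 (T : measurableType d1) (Z : measurableType d2) (R : realType).
Variable pi : probability (T * Z)%type R.

Section slice.
Variables (A : set T) (mA : measurable A).

(** The proof of measurability is an argument because the measure structure
    declared on [slice] depends on it. *)
Definition slice (_ : measurable A) (B : set Z) : \bar R := pi (A `*` B).

Let slice0 : slice mA set0 = 0.
Proof. by rewrite /slice setX0 measure0. Qed.

Let slice_ge0 B : 0 <= slice mA B.
Proof. exact: measure_ge0. Qed.

Let slice_sigma_additive : semi_sigma_additive (slice mA).
Proof.
move=> F mF tF mUF; rewrite /slice setX_bigcupr.
apply: measure_semi_sigma_additive.
- by move=> n; exact: measurableX.
- move/trivIsetP: tF => tF; apply/trivIsetP => i j _ _ ij.
  by rewrite -setXI setIid tF// setX0.
- by rewrite -setX_bigcupr; exact: measurableX.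
Qed.

HB.instance Definition _ := isMeasure.Build _ _ _
  (slice mA) slice0 slice_ge0 slice_sigma_additive.

Let slice_fin : fin_num_fun (slice mA).
Proof. by move=> B mB; apply: fin_num_measure; exact: measurableX. Qed.

HB.instance Definition _ := Measure_isFinite.Build _ _ _ (slice mA) slice_fin.

End slice.

Variable eta : probability Z R.
Hypothesis pi_snd : forall B, measurable B -> pi (setT `*` B) = eta B.

(** [F] is a version of the conditional probability, given the second
    coordinate, that the first coordinate is in [A]. *)
Definition is_conditional_probability (A : set T) (F : Z -> R) :=
  [/\ measurable_fun setT F, (forall z, 0 <= F z)%R &
      forall B, measurable B -> pi (A `*` B) = \int[eta]_(z in B) (F z)%:E].

Lemma conditional_probability A : measurable A ->
  exists F, is_conditional_probability A F.
Proof.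
move=> mA; have dom : slice mA `<< eta.
  apply/null_content_dominatesP => B mB eB0.
  have : pi (A `*` B) <= eta B.
    rewrite -pi_snd// le_measure ?inE//; [exact: measurableX..|].
    by move=> [t z] [].
  have -> : eta B = 0 by exact: eB0.
  by rewrite measure_le0 => /eqP.
have [f [f0 ffin /integrableP[mf _] fE]] := radon_nikodym_sigma_finite dom.
exists (fine \o f); split.
- exact: measurableT_comp.
- by move=> z; exact: fine_ge0.
- by move=> B mB; rewrite [LHS](fE B mB); apply: eq_integral => z _; rewrite /= fineK.
Qed.

(** A version for the difference set is nonnegative, and added to [F] it is
    another version for [A']. *)
Lemma conditional_probability_le A A' F F' : measurable A -> measurable A' ->
  A `<=` A' -> is_conditional_probability A F ->
  is_conditional_probability A' F' -> {ae eta, forall z, (F z <= F' z)%R}.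
Proof.
move=> mA mA' AA' [mF F0 FE] [mF' F'0 F'E].
have mD : measurable (A' `\` A) by exact: measurableD.
have [G [mG G0 GE]] := conditional_probability mD.
suff : ae_eq eta setT (EFin \o F') (fun z => (F z)%:E + (G z)%:E).
  apply: filterS => z /(_ I) [->]; by rewrite lerDl.
apply: integral_ae_eq => //.
- apply/integrableP; split; first exact/measurable_EFinP.
  rewrite (eq_integral (EFin \o F')); last first.
    by move=> z _; rewrite gee0_abs// lee_fin.
  by rewrite -F'E// (le_lt_trans (probability_le1 _ _)) ?ltry//; exact: measurableX.
- by apply: emeasurable_funD; exact/measurable_EFinP.
- move=> B _ mB; rewrite ge0_integralD//=.
  + rewrite -FE// -GE// -F'E// -measureU.
    * congr (pi _); apply/seteqP; split => -[t z] /=.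
        by move=> [A't Bz]; have [At|nAt] := pselect (A t); [left|right].
      by move=> [[/AA' At Bz]|[[At _] Bz]].
    * exact: measurableX.
    * exact: measurableX.
    * by rewrite -setXI setDE setICA setICr setI0 set0X.
  + by move=> z _; rewrite lee_fin.
  + exact/measurable_EFinP/measurable_funTS.
  + by move=> z _; rewrite lee_fin.
  + exact/measurable_EFinP/measurable_funTS.
Qed.

Lemma conditional_probability_le1 A F : measurable A ->
  is_conditional_probability A F -> {ae eta, forall z, (F z <= 1)%R}.
Proof.
move=> mA FA; apply: (@conditional_probability_le A setT F (cst 1%R)) => //.
by split => // B mB; rewrite pi_snd// -[LHS]mul1e -(integral_cst _ mB).
Qed.

End conditional_probability.

Section quantile_transform.
Context {R : realType}.

Local Notation U := (measurableTypeR R).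

Definition unif01 : probability U R := uniform_prob (@ltr01 R) : probability _ R.

Lemma unif01_Nyc (x : R) : (0 <= x <= 1)%R -> unif01 (`]-oo, x]%classic : set R) = x%:E.
Proof.
move=> /andP[x0 x1]; rewrite /unif01 /= /uniform_prob integral_uniform_pdf.
rewrite (_ : _ `&` _ = `[0%R, x]%classic); last first.
  apply/seteqP; split => u /=; rewrite !in_itv /=; first by move=> [-> /andP[->]].
  by move=> /andP[u0 ux]; rewrite u0 ux; split => //; exact: le_trans ux x1.
rewrite (eq_integral (cst 1)); last first.
  move=> u; rewrite inE /= in_itv /= => /andP[u0 ux].
  by rewrite /uniform_pdf u0 (le_trans ux x1) /= subr0 invr1.
rewrite integral_cst//= mul1e lebesgue_measure_itv /= lte_fin.
case: ltrP => [_|x_le0]; first by rewrite oppr0 adde0.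
by congr EFin; apply/eqP; rewrite eq_le x0 x_le0.
Qed.

Lemma rational_seq : exists w : nat -> R, forall x y : R, (x < y)%R ->
  exists n, (x < w n < y)%R.
Proof.
exists (fun n => if unpickle n is Some q then ratr q else 0%R) => x y xy.
have [q] := rat_in_itvoo xy; rewrite in_itv /= => qxy.
by exists (pickle q); rewrite pickleK.
Qed.

(** Left-continuity of distribution functions. *)
Lemma measure_Nyo_le d (Z : measurableType d) (m : {measure set (R * Z) -> \bar R})
    (t : R) (B : set Z) (a : \bar R) : measurable B ->
  (forall s, (s < t)%R -> m (`]-oo, s]%classic `*` B) <= a) ->
  m (`]-oo, t[%classic `*` B) <= a.
Proof.
move=> mB ma; pose S n : set R := `]-oo, (t - n.+1%:R^-1)%R]%classic.
have SE : `]-oo, t[%classic `*` B = \bigcup_n (S n `*` B).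
  apply/seteqP; split => -[s z] /=; rewrite ?in_itv /=.
    move=> [st Bz]; have ts0 : (0 < t - s)%R by rewrite subr_gt0.
    have [n _ /(_ n (leqnn n)) /= nts] := near_infty_natSinv_lt (PosNum ts0).
    by exists n => //; split => //=; rewrite /S /= in_itv /= lerBrDr -lerBrDl ltW.
  move=> [n _ [/= + Bz]]; rewrite /S /= in_itv /= => sn; split => //.
  by apply: (le_lt_trans sn); rewrite ltrBlDr ltrDl.
have mS n : measurable (S n `*` B).
  by apply: measurableX => //; exact: measurable_itv.
have mU : measurable (\bigcup_n (S n `*` B)) by exact: bigcupT_measurable.
have ndS : nondecreasing_seq (fun n => S n `*` B).
  move=> i j ij; apply/subsetPset => -[s z] [] /=; rewrite /S /= !in_itv /= => si.
  split => //=; apply: (le_trans si); rewrite lerD2l lerN2.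
  by rewrite lef_pV2 ?posrE// ler_nat ltnS.
have cvgS := @nondecreasing_cvg_mu _ _ _ m _ mS mU ndS.
rewrite SE -(cvg_lim _ cvgS)//; apply: lime_le.
  by apply/cvg_ex; eexists; exact: cvgS.
by apply: nearW => n; apply: ma; rewrite ltrBlDr ltrDl.
Qed.

Lemma measureU_null d (T : measurableType d) (m : {measure set T -> \bar R})
    (A N : set T) (a : \bar R) : measurable A -> measurable N ->
  m A <= a -> m N = 0 -> m (A `|` N) <= a.
Proof.
move=> mA mN Aa N0; have N0' : m N <= 0 by rewrite N0.
by apply: le_trans (measureU2 _ mA mN) _; rewrite -[leRHS]adde0; exact: leeD.
Qed.

Lemma measurable_prod_rays d (Z : measurableType d) : @measurable _ (R * Z)%type =
  <<s [set `]-oo, t[%classic `*` B | t in [set: R] & B in measurable] >>.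
Proof.
apply/seteqP; split; last first.
  apply: smallest_sub; first exact: sigma_algebra_measurable.
  by move=> _ [t _ [B mB <-]]; exact: measurableX.
set H := [set _ | _ in _ & _ in _].
pose T := g_sigma_algebraType (H : set (set (R * Z))).
apply: smallest_sub; first exact: smallest_sigma_algebra.
rewrite subUset; split; last first.
  move=> _ [B mB <-]; rewrite setTI.
  rewrite (_ : _ @^-1` _ = \bigcup_n (`]-oo, n%:R%R[%classic `*` B)).
    apply: (@bigcupT_measurable _ T) => n; apply: sub_sigma_algebra.
    by exists n%:R%R => //; exists B.
  apply/seteqP; split => [[t z] Bz|[t z] [n _ []//]].
  by exists (Num.truncn t).+1 => //; split => //=; rewrite in_itv /= truncnS_gt.
suff mfst : @measurable_fun _ _ T R setT fst by move=> _ [Y mY <-]; exact: mfst.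
apply: (measurability (@RGenInftyO.G R)); first exact: RGenInftyO.measurableE.
move=> _ [_ [t ->] <-]; rewrite setTI -setXT.
by apply: sub_sigma_algebra; exists t => //; exists setT.
Qed.

Lemma probability_pushforward d d' (T : measurableType d) (T' : measurableType d')
    (P : probability T R) (f : T -> T') : measurable_fun setT f ->
  exists Q : probability T' R, forall A, Q A = P (f @^-1` A).
Proof.
move=> mf; pose fm := isMeasurableFun.Build _ _ _ _ _ mf.
pose F : {mfun T >-> T'} := HB.pack f fm.
by exists (distribution P F).
Qed.

Context d (Z : measurableType d) (pi : probability (R * Z)%type R)
  (eta : probability Z R).
Hypothesis pi_snd : forall B, measurable B -> pi (setT `*` B) = eta B.
Hypothesis pi_lt0 : pi (`]-oo, 0%R[ `*` setT) = 0.
Hypothesis pi_gt1 : pi (`]1%R, +oo[ `*` setT) = 0.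

(** [G (z, u)] is the infimum of the points [w n] of a dense sequence at which
    the conditional distribution function [F n] at [z] has reached [u]. Since
    the first coordinate lies in [0, 1] almost surely, the point 1 can be added
    and negative [w n] discarded, which makes the infimum finite everywhere.
    Versions of the distribution function at different points are compared
    almost everywhere only; this yields two inequalities between the laws of
    half-lines with different endpoints, which coincide in the limit. *)
Lemma quantile_transform : exists2 G : Z * U -> R, measurable_fun setT G &
  forall S, measurable S -> (eta \x unif01) ((fun p => (G p, p.1)) @^-1` S) = pi S.
Proof.
have [w wP] := rational_seq.
pose A n : set R := `]-oo, w n]%classic.
have /(@choice nat (Z -> R))[F FP] :
    forall n, exists F, is_conditional_probability pi eta (A n) F.
  by move=> n; apply: (conditional_probability pi_snd); exact: measurable_itv.
pose I t (p : Z * U) n := [/\ (0 <= w n)%R, (w n < t)%R & (p.2 <= F n p.1)%R].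
pose V p := [set 1%R] `|` [set w n | n in [set n | (0 <= w n)%R /\ (p.2 <= F n p.1)%R]].
have infV p : has_inf (V p).
  split; first by exists 1%R; left.
  by exists 0%R => _ [->|[n [w0 _] <-]]; first exact: ler01.
pose G p := inf (V p).
have GE t p : (G p < t)%R <-> (1 < t)%R \/ exists n, I t p n.
  split.
    move=> Gt; have tG : (0 < t - G p)%R by rewrite subr_gt0.
    have [v Vv] := inf_adherent tG (infV p); rewrite -/(G p) subrKC => vt.
    move: Vv vt => [->|[n [w0 pF] <-]] vt; first by left.
    by right; exists n.
  move=> [t1|[n [w0 wt pF]]].
    by apply: le_lt_trans t1; apply: ge_inf; [case: (infV p)|left].
  by apply: le_lt_trans wt; apply: ge_inf; [case: (infV p)|right; exists n].
pose E n := [set p : Z * U | (p.2 <= F n p.1)%R].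
have mE n : measurable (E n).
  have mle : measurable_fun setT (fun p : Z * U => (p.2 <= F n p.1)%R).
    apply: measurable_fun_ler; first exact: measurable_snd.
    by apply: measurableT_comp; [case: (FP n)|exact: measurable_fst].
  by rewrite -[X in measurable X]setTI; exact: (mle measurableT [set true]).
have mG : measurable_fun setT G.
  apply: (measurability (@RGenInftyO.G R)); first exact: RGenInftyO.measurableE.
  move=> _ [_ [t ->] <-]; rewrite setTI.
  rewrite (_ : _ @^-1` _ = (if (1 < t)%R then setT else set0) `|`
      \bigcup_n (if (0 <= w n < t)%R then E n else set0)).
    apply: measurableU; first by case: ifP.
    by apply: bigcupT_measurable => n; case: ifP => _; [exact: mE|exact: measurable0].
  apply/seteqP; split => p; rewrite /= in_itv /=.
    move=> /GE[t1|[n [w0 wt pF]]]; first by left; rewrite t1.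
    by right; exists n => //; rewrite w0 wt.
  - move=> h; apply/GE; case: h; first by case: ifP => // t1 _; left.
    by move=> [n _]; case: ifP => // /andP[w0 wt] pF; right; exists n.
have mGp : measurable_fun setT (fun p : Z * U => (G p, p.1)).
  by apply: measurable_fun_pair => //; exact: measurable_fst.
have [Q QE] := probability_pushforward (eta \x unif01) mGp.
have mA n : measurable (A n) by exact: measurable_itv.
(* At fixed [z] the set [E n] is the half-line below [F n z]. *)
have EE n B : measurable B ->
    (eta \x unif01) (E n `&` (B `*` setT)) = pi (A n `*` B).
  move=> mB; have [mF F0 ->//] := FP n.
  rewrite /product_measure1.
  have -> : (unif01 \o xsection (E n `&` (B `*` setT))) =
      (unif01 \o xsection (E n)) \_ B.
    apply/funext => z /=; rewrite patchE.
    case: ifPn => [|]; rewrite ?inE ?notin_setE => Bz.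
      congr (unif01 _); apply/seteqP; split => u /xsectionP.
        by move=> [? _]; apply/xsectionP.
      by move=> Ez; apply/xsectionP.
    rewrite (_ : xsection _ _ = set0) ?measure0//.
    by apply/seteqP; split => u // /xsectionP[_ []].
  rewrite -integral_mkcond.
  apply: ae_eq_integral => //.
  - by apply: measurable_funTS; exact: measurable_fun_xsection.
  - by apply/measurable_EFinP/measurable_funTS.
  - have := conditional_probability_le1 pi_snd (mA n) (FP n).
    apply: filterS => z Fz1 _; rewrite -unif01_Nyc ?F0//=; congr (unif01 _).
    apply/seteqP; split => u; rewrite /= in_itv /=; first by move=> /xsectionP.
    by move=> ?; apply/xsectionP.
have EUT B : measurable B -> (eta \x unif01) (B `*` setT) = eta B.
  move=> mB; rewrite product_measure1E// [X in _ * X](_ : _ = 1) ?mule1//.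
  exact: probability_setT.
(* Outside the null set [N] where [F] fails to be monotone, a point with
   [G < t <= 1] satisfies [u <= F r z] for every [w r] beyond [t]. *)
have upper r t B : measurable B -> (t <= w r)%R ->
    Q (`]-oo, t[%classic `*` B) <= pi (A r `*` B).
  move=> mB tr; rewrite QE.
  have mQ : measurable ((fun p => (G p, p.1)) @^-1` (`]-oo, t[%classic `*` B)).
    by rewrite -[X in measurable X]setTI; apply: mGp => //; exact: measurableX.
  have [t1|t1] := ltP 1%R t.
    apply: (@le_trans _ _ ((eta \x unif01) (B `*` setT))).
      by rewrite le_measure ?inE//; [exact: measurableX|move=> [z u] []].
    rewrite EUT// -pi_snd//.
    apply: (@le_trans _ _ (pi ((A r `*` B) `|` (`]1%R, +oo[%classic `*` setT)))).
      rewrite le_measure ?inE//; first exact: measurableX.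
        by apply: measurableU; exact: measurableX.
      move=> [s z] [_ /= Bz]; have [sr|rs] := leP s (w r); [left|right].
        by split => //=; rewrite /A /= in_itv.
      split => //=; rewrite in_itv /= andbT; apply: lt_trans rs.
      exact: lt_le_trans tr.
    by apply: measureU_null => //; exact: measurableX.
  have [N [mN N0 FN]] : {ae eta, forall z n, (w n <= w r)%R -> (F n z <= F r z)%R}.
    apply: ae_foralln => n; have [nr|nr] := leP (w n) (w r); last exact: aeW.
    have := conditional_probability_le pi_snd (mA n) (mA r) _ (FP n) (FP r).
    move=> /(_ _)/filterS; apply => //.
    by move=> s; rewrite /A /= !in_itv /= => /le_trans; apply.
  apply: (@le_trans _ _ ((eta \x unif01) ((E r `&` (B `*` setT)) `|` (N `*` setT)))).
    rewrite le_measure ?inE//.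
      by apply: measurableU; [apply: measurableI => //|]; exact: measurableX.
    move=> [z u] [/= + Bz]; rewrite in_itv /= => /GE[|[n [w0 wt uF]]].
      by rewrite ltNge t1.
    have [Nz|Nz] := pselect (N z); [by right|left; split => //].
    apply: (le_trans uF); apply: contrapT => nF; apply/Nz/FN => /(_ n) h.
    by apply/nF/h/ltW; exact: lt_le_trans tr.
  apply: measureU_null.
  - by apply: measurableI => //; exact: measurableX.
  - exact: measurableX.
  - by have /eqP := EE r B mB; rewrite eq_le => /andP[].
  - exact: etrans (EUT N mN) N0.
have lower r t B : measurable B -> (0 <= w r)%R -> (w r < t)%R ->
    pi (A r `*` B) <= Q (`]-oo, t[%classic `*` B).
  move=> mB w0 wt; rewrite QE -EE// le_measure ?inE//.
  - by apply: measurableI => //; exact: measurableX.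
  - by rewrite -[X in measurable X]setTI; apply: mGp => //; exact: measurableX.
  - move=> [z u] [/= uF [Bz _]]; split => //=; rewrite in_itv /=.
    by apply/GE; right; exists r.
have mray t B : measurable B -> measurable (`]-oo, t[%classic `*` B : set (R * Z)).
  by move=> mB; exact: measurableX.
have mrayc t B : measurable B -> measurable (`]-oo, t]%classic `*` B : set (R * Z)).
  by move=> mB; exact: measurableX.
exists G => // S mS; rewrite -QE.
apply: (@measure_unique _ R (R * Z)%type
  [set `]-oo, t[%classic `*` B | t in [set: R] & B in measurable]
  (fun n => `]-oo, n%:R%R[%classic `*` setT) _ _ _ _ Q pi) => //.
- exact: measurable_prod_rays.
- move=> _ _ [t _ [B mB <-]] [t' _ [B' mB' <-]].
  exists (Num.min t t') => //; exists (B `&` B'); first exact: measurableI.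
  rewrite -setXI; congr (_ `*` _); apply/seteqP; split => s /=;
    rewrite !in_itv /= lt_min.
    by move/andP.
  by move=> [-> ->].
- by move=> n; exists n%:R%R => //; exists setT.
- apply/seteqP; split => // -[s z] _; exists (Num.truncn s).+1 => //.
  by split => //=; rewrite in_itv /= truncnS_gt.
- move=> _ [t _ [B mB <-]]; apply/eqP; rewrite eq_le; apply/andP; split.
    apply: measure_Nyo_le => // s /wP[r /andP[sr rt]].
    apply: (@le_trans _ _ (Q (`]-oo, w r[%classic `*` B))).
      rewrite le_measure ?inE//; [exact: mrayc|exact: mray|].
      by move=> [x z] []; rewrite /= !in_itv /= => xs Bz; split => //;
        exact: le_lt_trans xs sr.
    apply: le_trans (upper r _ _ _ _) _ => //.
    rewrite le_measure ?inE//; [exact: mrayc|exact: mray|].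
    by move=> [x z] []; rewrite /A /= !in_itv /= => xs Bz; split => //;
      exact: le_lt_trans xs rt.
  apply: measure_Nyo_le => // s st; have [s0|s0] := ltP s 0%R.
    apply: (@le_trans _ _ 0); last exact: measure_ge0.
    rewrite -pi_lt0 le_measure ?inE//; [exact: mrayc|exact: mray|].
    by move=> [x z] []; rewrite /= !in_itv /= => xs Bz; split => //;
      exact: le_lt_trans xs s0.
  have [r /andP[sr rt]] := wP _ _ st.
  apply: le_trans (lower r _ _ mB _ rt); last exact/ltW/(le_lt_trans s0).
  rewrite le_measure ?inE//; [exact: mrayc|exact: mrayc|].
  move=> [x z] []; rewrite /= /A /= !in_itv /= => /le_trans h Bz.
  by split => //; apply/h/ltW.
- by move=> k; rewrite (le_lt_trans (probability_le1 _ _)) ?ltry//; exact: mray.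
Qed.
End quantile_transform.

(** * Integrals of functions with an integrable negative part *)

Section extended_integral.
Context d (T : measurableType d) (R : realType) (m : {measure set T -> \bar R}).
Implicit Types f g : T -> \bar R.

Lemma ae_le_integral_ext f g : measurable_fun setT f -> measurable_fun setT g ->
  {ae m, forall x, f x <= g x} -> \int[m]_x f x <= \int[m]_x g x.
Proof.
move=> mf mg fg; rewrite integralE [leRHS]integralE; apply: leeB.
  apply: ae_ge0_le_integral => //; [exact: measurable_funepos..|].
  apply: filterS fg => x fgx _; rewrite !funeposE.
  by rewrite ge_max !le_max fgx lexx orbT.
apply: ae_ge0_le_integral => //; [exact: measurable_funeneg..|].
apply: filterS fg => x fgx _; rewrite !funenegE.
by rewrite ge_max !le_max leeN2 fgx lexx orbT.
Qed.

(** The integral of f + g is expanded from the identity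
    h^+ + (f^- + g^-) = h^- + (f^+ + g^+) between nonnegative functions, where
    h = f + g; the integrals of the negative parts, h^- <= f^- + g^- included,
    are finite and can be cancelled. *)
Lemma integralD_ext f g : measurable_fun setT f -> measurable_fun setT g ->
  (forall x, -oo < f x) -> (forall x, -oo < g x) ->
  \int[m]_x f^\- x < +oo -> \int[m]_x g^\- x < +oo ->
  \int[m]_x (f x + g x) = \int[m]_x f x + \int[m]_x g x.
Proof.
move=> mf mg f_gt g_gt fneg gneg; pose h := f \+ g.
have mh : measurable_fun setT h by exact: emeasurable_funD.
have hneg_le x : h^\- x <= f^\- x + g^\- x.
  rewrite !funenegE /h /= ge_max; apply/andP; split; last first.
    by apply: adde_ge0; rewrite le_max lexx orbT.
  rewrite oppeD; last first.
    rewrite /adde_def; have := f_gt x; have := g_gt x.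
    by case: (f x) (g x) => [?| |] [?| |].
  by apply: leeD; rewrite le_max lexx.
have hneg : \int[m]_x h^\- x < +oo.
  apply: (@le_lt_trans _ _ (\int[m]_x (f^\- x + g^\- x))).
    apply: ge0_le_integral => //; first exact: measurable_funeneg.
    by apply: emeasurable_funD; exact: measurable_funeneg.
  rewrite ge0_integralD//; [exact: lte_add_pinfty|exact: measurable_funeneg..].
have key : \int[m]_x h^\+ x + (\int[m]_x f^\- x + \int[m]_x g^\- x) =
    \int[m]_x h^\- x + (\int[m]_x f^\+ x + \int[m]_x g^\+ x).
  have mfp := measurable_funepos mf; have mgp := measurable_funepos mg.
  have mfn := measurable_funeneg mf; have mgn := measurable_funeneg mg.
  have mhp := measurable_funepos mh; have mhn := measurable_funeneg mh.
  have maxNy0 : maxe (-oo : \bar R) 0 = 0 by apply: max_r; rewrite leNye.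
  have maxy0 : maxe (+oo : \bar R) 0 = +oo by apply: max_l; rewrite leey.
  have sum3 u v w : measurable_fun setT u -> measurable_fun setT v ->
      measurable_fun setT w -> (forall x, 0 <= u x) -> (forall x, 0 <= v x) ->
      (forall x, 0 <= w x) ->
      \int[m]_x u x + (\int[m]_x v x + \int[m]_x w x) =
      \int[m]_x (u x + (v x + w x)).
    move=> mu mv mw u0 v0 w0; rewrite [RHS]ge0_integralD//.
    - by rewrite [in RHS]ge0_integralD.
    - by move=> x _; exact: adde_ge0.
    - exact: emeasurable_funD.
  rewrite !sum3//.
  apply: eq_integral => x _; rewrite !funeposE !funenegE /h /=.
  have := f_gt x; have := g_gt x; case: (f x) (g x) => [a| |] [b| |] //= _ _.
  - rewrite -?EFinD -?EFinN -!EFin_max -!EFinD; congr EFin.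
    have maxN (t : R) : (Num.max t 0 = Num.max (- t) 0 + t)%R.
      by case: (leP t 0%R) => t0; case: (leP (- t)%R 0%R) => t1; lra.
    by rewrite (maxN (a + b)%R) (maxN a) (maxN b); lra.
  - by rewrite maxNy0 maxy0 -!EFin_max.
  - by rewrite maxNy0 maxy0 -!EFin_max.
  - by rewrite maxNy0 maxy0.
rewrite integralE [X in _ = X + _]integralE [X in _ = _ + X]integralE -/h.
have : 0 <= \int[m]_x h^\+ x by apply: integral_ge0.
have : 0 <= \int[m]_x f^\+ x by apply: integral_ge0.
have : 0 <= \int[m]_x g^\+ x by apply: integral_ge0.
have : 0 <= \int[m]_x h^\- x by apply: integral_ge0.
have : 0 <= \int[m]_x f^\- x by apply: integral_ge0.
have : 0 <= \int[m]_x g^\- x by apply: integral_ge0.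
move: key hneg fneg gneg.
move: (\int[m]_x h^\+ x) (\int[m]_x f^\+ x) (\int[m]_x g^\+ x).
move: (\int[m]_x h^\- x) (\int[m]_x f^\- x) (\int[m]_x g^\- x).
move=> [c| |] // [a| |] // [b| |] // [p| |] // [q| |] // [r| |] //=.
rewrite -!EFinD => -[key] _ _ _ _ _ _ _ _ _; congr EFin; lra.
Qed.

Lemma integral_transfer d' (T' : measurableType d') (Q : {measure set T' -> \bar R})
    (h : T -> T') (f : T' -> \bar R) : measurable_fun setT h ->
  (forall A, measurable A -> Q A = m (h @^-1` A)) -> measurable_fun setT f ->
  \int[Q]_y f y = \int[m]_x f (h x).
Proof.
move=> mh Qh mf; rewrite (@eq_measure_integral _ _ _ _ (pushforward m h)); last first.
  by move=> A mA _; exact: Qh.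
rewrite integralE [RHS]integralE; congr (_ - _).
  rewrite (ge0_integral_pushforward mh _ measurableT (measurable_funepos mf))//.
  by apply: eq_integral => x _; rewrite /= !funeposE.
rewrite (ge0_integral_pushforward mh _ measurableT (measurable_funeneg mf))//.
by apply: eq_integral => x _; rewrite /= !funenegE.
Qed.

End extended_integral.

(** * Countable mixtures of probability measures *)

Section countable_mixture.
Context d (T : measurableType d) (R : realType) (P : nat -> probability T R).

Definition mixture_weight n : {nonneg R} := ((2 ^ n.+1)%:R^-1)%:nng%R.

Definition mixture : set T -> \bar R :=
  mseries (fun n => mscale (mixture_weight n) (P n)) 0.

HB.instance Definition _ := Measure.on mixture.

Lemma mixture_marginal (A : set T) (a : R) :
  (forall n, P n A = a%:E) -> mixture A = a%:E.
Proof.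
move=> PA; apply/cvg_lim => //.
have := @cvg_geometric_eseries_half R a 0; rewrite expr0 divr1.
rewrite (_ : eseries _ =
  fun n => \sum_(0 <= i < n) mscale (mixture_weight i) (P i) A)//.
apply/funext => n; apply: eq_bigr => i _.
by rewrite /mscale [X in _ * X](PA i) -EFinM addn1 mulrC.
Qed.

Let mixtureT : mixture setT = 1.
Proof. by apply: mixture_marginal => n; exact: probability_setT. Qed.

HB.instance Definition _ := Measure_isProbability.Build _ _ _ mixture mixtureT.

Lemma mixture_integral_ge (f : T -> \bar R) n : (forall x, 0 <= f x) ->
  measurable_fun setT f ->
  (mixture_weight n)%:num%:E * \int[P n]_x f x <= \int[mixture]_x f x.
Proof.
move=> f0 mf; rewrite -ge0_integral_mscale//.
apply: ge0_le_measure_integral => // A mA.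
have := @nneseries_lim_ge R
  (fun k => mscale (mixture_weight k) (P k) A) xpredT 0%N n.+1.
move=> /(_ (fun _ _ _ => measure_ge0 _ _)); apply: le_trans.
by rewrite big_nat_recr//= leeDr// sume_ge0.
Qed.

End countable_mixture.

(** * Gluing couplings *)

Section gluing.
Context {R : realType}.
Local Notation U := (measurableTypeR R).

(** The quantile transform, transported from the real line to a Polish space by
    a Borel retraction. *)
Lemma noise_outsourcing (X : ptopologicalType) d (Z : measurableType d)
    (pi : probability (Borel X * Z)%type R) (eta : probability Z R) :
  polish R X -> (forall B, measurable B -> pi (setT `*` B) = eta B) ->
  exists2 g : Z * U -> Borel X, measurable_fun setT g &
  forall S, measurable S ->
    (eta \x unif01) ((fun p => (g p, p.1)) @^-1` S) = pi S.
Proof.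
move=> hX pi_snd; have [e [r [me mr e01 eK]]] := polish_real_retract hX.
have mep : measurable_fun setT (fun p : Borel X * Z => (e p.1, p.2)).
  apply: measurable_fun_pair => //.
  exact: measurableT_comp measurable_fst.
have [pi' pi'E] := probability_pushforward pi mep.
have empty (I : set R) : (forall x, I (e x) -> False) -> pi' (I `*` setT) = 0.
  move=> eI; rewrite pi'E (_ : _ @^-1` _ = set0) ?measure0//.
  by apply/seteqP; split => // p [/eI].
have [|||G mG GE] := @quantile_transform R _ Z pi' eta.
- by move=> B mB; rewrite pi'E -pi_snd.
- by apply: empty => x; rewrite /= in_itv /= ltNge; have /andP[->] := e01 x.
- by apply: empty => x; rewrite /= in_itv /= andbT ltNge; have /andP[_ ->] := e01 x.
exists (r \o G); first exact: measurableT_comp.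
move=> S mS; pose S' : set (R * Z) := (fun p => (r p.1, p.2)) @^-1` S.
have mS' : measurable S'.
  rewrite -[X in measurable X]setTI.
  have mrp : measurable_fun setT (fun p : R * Z => (r p.1, p.2) : Borel X * Z).
    apply: measurable_fun_pair => //.
    exact: measurableT_comp measurable_fst.
  exact: mrp.
have := GE S' mS'; rewrite /S' /= => ->; rewrite pi'E; congr (pi _).
by apply/seteqP; split => -[x z] /=; rewrite eK.
Qed.

Lemma gluing (X Y : ptopologicalType) d (Z : measurableType d)
    (pi : probability (Borel X * Z)%type R) (rho : probability (Borel Y * Z)%type R)
    (eta : probability Z R) : polish R X -> polish R Y ->
  (forall B, measurable B -> pi (setT `*` B) = eta B) ->
  (forall B, measurable B -> rho (setT `*` B) = eta B) ->
  exists d' (W : measurableType d') (P : probability W R)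
    (a : W -> Borel X) (b : W -> Borel Y) (z : W -> Z),
  [/\ measurable_fun setT a, measurable_fun setT b, measurable_fun setT z,
      forall S, measurable S -> pi S = P ((fun w => (a w, z w)) @^-1` S) &
      forall S, measurable S -> rho S = P ((fun w => (b w, z w)) @^-1` S)].
Proof.
move=> hX hY pi_snd rho_snd.
have [g mg gE] := noise_outsourcing hX pi_snd.
have [k mk kE] := noise_outsourcing hY rho_snd.
pose P : probability ((Z * U) * U)%type R := (eta \x unif01) \x unif01.
have m1 : measurable_fun setT (fst : (Z * U) * U -> Z * U) by exact: measurable_fst.
have m2 : measurable_fun setT (fun w : (Z * U) * U => (w.1.1, w.2)).
  apply: measurable_fun_pair => //.
  exact: measurableT_comp measurable_fst m1.
have mgp : measurable_fun setT (fun p => (g p, p.1)).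
  by apply: measurable_fun_pair => //; exact: measurable_fst.
have mkp : measurable_fun setT (fun p => (k p, p.1)).
  by apply: measurable_fun_pair => //; exact: measurable_fst.
have P1 S : measurable S -> P (fst @^-1` S) = (eta \x unif01) S.
  move=> mS; rewrite -setXT; apply: etrans (product_measure1E _ _ mS measurableT) _.
  by rewrite [X in _ * X](_ : _ = 1) ?mule1//; exact: probability_setT.
have P2 S : measurable S -> P ((fun w => (w.1.1, w.2)) @^-1` S) = (eta \x unif01) S.
  move=> mS; have [Q QE] := probability_pushforward P m2.
  rewrite -QE; apply/esym; apply: product_measure_unique => // A B mA mB.
  apply: etrans (QE _) _; rewrite (_ : _ @^-1` _ = (A `*` setT) `*` B); last first.
    by apply/seteqP; split => -[[z u] v] /=; [case|case=> -[]].
  have mAT : measurable (A `*` setT : set (Z * U)) by exact: measurableX.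
  apply: etrans (product_measure1E _ _ mAT mB) _; congr (_ * _).
  apply: etrans (product_measure1E _ _ mA measurableT) _.
  by rewrite [X in _ * X](_ : _ = 1) ?mule1//; exact: probability_setT.
exists _, ((Z * U) * U)%type, P.
exists (g \o fst), (k \o (fun w => (w.1.1, w.2))), (fst \o fst).
split.
- exact: measurableT_comp.
- exact: measurableT_comp.
- exact: measurableT_comp measurable_fst m1.
- move=> S mS; rewrite -gE// -P1//.
  by rewrite -[X in measurable X]setTI; exact: mgp.
- move=> S mS; rewrite -kE// -P2//.
  by rewrite -[X in measurable X]setTI; exact: mkp.
Qed.

End gluing.

(** * Transport costs *)

(** By second countability, an open set of the product is a countable union of
    open rectangles. *)
Lemma open_prod_measurable (R : realType) (X : ptopologicalType) (O : set (X * X)) :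
  polish R X -> open O -> measurable (O : set (Borel X * Borel X)).
Proof.
move=> /polish_second_countable[V [oV VP]] oO.
rewrite (_ : O = \bigcup_i \bigcup_j
    (if `[< V i `*` V j `<=` O >] then V i `*` V j else set0)); last first.
  apply/seteqP; split => [[x y] Oxy|[x y] [i _ [j _]]]; last first.
    by case: asboolP => // VO Vxy; exact: VO.
  have := open_nbhs_nbhs (conj oO Oxy) => -[[A B] /= [nA nB] ABO].
  have [i [Vix ViA]] := VP _ x (open_interior A) nA.
  have [j [Vjy VjB]] := VP _ y (open_interior B) nB.
  exists i => //; exists j => //; case: asboolP => // nVO; exfalso; apply: nVO.
  move=> [x' y'] [/= /ViA/interior_subset Ax /VjB/interior_subset By].
  exact: (ABO (x', y')).
apply: bigcupT_measurable => i; apply: bigcupT_measurable => j.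
case: ifP => // _; apply: measurableX; exact: sub_sigma_algebra.
Qed.

Lemma measurable_lsc_prod (R : realType) (X : ptopologicalType)
    (c : X * X -> \bar R) : polish R X -> lower_semicontinuous c ->
  measurable_fun [set: Borel X * Borel X] c.
Proof.
move=> hX lsc; apply: (measurability _ (ErealGenOInfty.measurableE R)).
move=> /= _ [_ [a ->]] <-; rewrite setTI preimage_itvoy.
by apply: (open_prod_measurable hX); move/lower_semicontinuousP : lsc; exact.
Qed.

Section transport_cost.
Context {d1 d2 : measure_display} {T1 : measurableType d1}
  {T2 : measurableType d2} {R : realType}.
Variables (mu : probability T1 R) (nu : probability T2 R).
Variable f : T1 * T2 -> \bar R.
Hypothesis mf : measurable_fun setT f.

Lemma couplings_law d (W : measurableType d) (P : probability W R)
    (a : W -> T1) (b : W -> T2) (pi : probability (T1 * T2)%type R) :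
  (forall S, measurable S -> pi S = P ((fun w => (a w, b w)) @^-1` S)) ->
  (forall A, measurable A -> P (a @^-1` A) = mu A) ->
  (forall B, measurable B -> P (b @^-1` B) = nu B) -> couplings mu nu pi.
Proof.
move=> piE aE bE; split => A mA; rewrite /pushforward piE ?aE ?bE//.
  by rewrite -setXT; exact: measurableX.
by rewrite -setTX; exact: measurableX.
Qed.

Lemma OT_le pi : couplings mu nu pi -> OT mu nu f <= \int[pi]_p f p.
Proof. by move=> cpi; apply: ereal_inf_lbound; exists pi. Qed.

(** Couplings of cost below -n * 2^(n+1) would mix, with weights 2^-(n+1), into a
    coupling for which the integral of the negative part of [f] is at least [n]
    for all [n]. *)
Lemma OT_gtNy : OT_well_defined mu nu f -> -oo < OT mu nu f.
Proof.
move=> wd; rewrite ltNye; apply/negP => /eqP OTNy.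
have /choice[pi piP] : forall n, exists pi, couplings mu nu pi /\
    \int[pi]_p f p < (- ((2 ^ n.+1)%:R * n%:R))%:E.
  move=> n; have : OT mu nu f < (- ((2 ^ n.+1)%:R * n%:R))%:E by rewrite OTNy ltNyr.
  by move=> /ereal_inf_lt[_ [pi cpi <-] lt]; exists pi.
have cmix : couplings mu nu (mixture pi).
  split => A mA; rewrite /pushforward.
    rewrite -[RHS]fineK ?fin_num_measure//; apply: mixture_marginal => n.
    by rewrite fineK ?fin_num_measure//; have [[piA _] _] := piP n; exact: piA.
  rewrite -[RHS]fineK ?fin_num_measure//; apply: mixture_marginal => n.
  by rewrite fineK ?fin_num_measure//; have [[_ piA] _] := piP n; exact: piA.
have := wd _ cmix; apply/negP; rewrite -leNgt.
suff ge n : n%:R%:E <= \int[mixture pi]_x f^\- x.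
  rewrite (@eq_infty _ (\int[mixture pi]_x f^\- x))// => A.
  apply: le_trans (ge (Num.truncn A).+1); rewrite lee_fin; exact/ltW/truncnS_gt.
apply: le_trans (mixture_integral_ge pi n _ (measurable_funeneg mf)) => //.
have K_le : ((2 ^ n.+1)%:R * n%:R)%:E <= \int[pi n]_x f^\- x.
  rewrite -leeN2 -EFinN; have [_ /ltW] := piP n; apply: le_trans.
  by rewrite [leRHS]integralE leeDr// integral_ge0.
apply: (@le_trans _ _ ((mixture_weight R n)%:num%:E * ((2 ^ n.+1)%:R * n%:R)%:E)).
  by rewrite -EFinM /= mulrA mulVf ?mul1r.
by apply: lee_wpmul2l K_le; rewrite lee_fin.
Qed.

End transport_cost.

Lemma le_ereal_infD (R : realType) (A B : set (\bar R)) (x : \bar R) :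
  -oo < ereal_inf A -> -oo < ereal_inf B ->
  (forall a b, A a -> B b -> x <= a + b) -> x <= ereal_inf A + ereal_inf B.
Proof.
move=> Agt Bgt xAB.
have [->|Ay] := eqVneq (ereal_inf A) +oo; first by rewrite addye ?leey// gt_eqF.
have [->|By] := eqVneq (ereal_inf B) +oo; first by rewrite addey ?leey// gt_eqF.
have finA : ereal_inf A \is a fin_num by rewrite fin_numE gt_eqF.
have finB : ereal_inf B \is a fin_num by rewrite fin_numE gt_eqF.
apply/lee_addgt0Pr => e e0; have e20 : (0 < e / 2)%R by rewrite divr_gt0.
have [a Aa lta] := lb_ereal_inf_adherent e20 finA.
have [b Bb ltb] := lb_ereal_inf_adherent e20 finB.
apply: (le_trans (xAB _ _ Aa Bb)); rewrite [in leRHS](splitr e) EFinD addeACA.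
by apply: leeD; exact: ltW.
Qed.

(** * Factored costs *)

Section factored_cost.
Context {R : realType} {X : ptopologicalType} (hX : polish R X)
  {Z : ptopologicalType} (hZ : polish R Z).
Variables (c : X * X -> \bar R) (psi : X * Z -> \bar R).
Hypothesis c_gtNy : forall p, -oo < c p.
Hypothesis mc : measurable_fun [set: Borel X * Borel X] c.
Hypothesis psi_gtNy : forall p, -oo < psi p.
Hypothesis mpsi : measurable_fun [set: Borel X * Borel Z] psi.
Hypothesis c_inf : forall x y : X,
  c (x, y) = ereal_inf [set psi (x, z) + psi (y, z) | z in [set: Z]].
Variables mu nu : probability (Borel X) R.
Hypothesis psi_int_mu : forall eta : probability (Borel Z) R,
  OT_well_defined mu eta psi.
Hypothesis psi_int_nu : forall eta : probability (Borel Z) R,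
  OT_well_defined nu eta psi.

Lemma integral_psiD (eta : probability (Borel Z) R) d (W : measurableType d)
    (P : probability W R) (a b : W -> Borel X) (z : W -> Borel Z)
    (pi rho : probability (Borel X * Borel Z)%type R) :
  measurable_fun setT a -> measurable_fun setT b -> measurable_fun setT z ->
  (forall S, measurable S -> pi S = P ((fun w => (a w, z w)) @^-1` S)) ->
  (forall S, measurable S -> rho S = P ((fun w => (b w, z w)) @^-1` S)) ->
  couplings mu eta pi -> couplings nu eta rho ->
  \int[P]_w (psi (a w, z w) + psi (b w, z w)) =
  \int[pi]_p psi p + \int[rho]_p psi p.
Proof.
move=> ma mb mz piE rhoE cpi crho.
have maz : measurable_fun setT (fun w => (a w, z w)) by exact: measurable_fun_pair.
have mbz : measurable_fun setT (fun w => (b w, z w)) by exact: measurable_fun_pair.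
rewrite integralD_ext//=.
- by rewrite -(integral_transfer maz piE mpsi) -(integral_transfer mbz rhoE mpsi).
- exact: measurableT_comp maz.
- exact: measurableT_comp mbz.
- have := psi_int_mu cpi.
  rewrite (integral_transfer maz piE (measurable_funeneg mpsi)).
  under eq_integral do rewrite funenegE.
  by under [X in _ -> X < _]eq_integral do rewrite funenegE.
- have := psi_int_nu crho.
  rewrite (integral_transfer mbz rhoE (measurable_funeneg mpsi)).
  under eq_integral do rewrite funenegE.
  by under [X in _ -> X < _]eq_integral do rewrite funenegE.
Qed.

Lemma OT_le_factored (eta : probability (Borel Z) R) :
  OT mu nu c <= OT mu eta psi + OT nu eta psi.
Proof.
apply: le_ereal_infD; [exact: OT_gtNy|exact: OT_gtNy|].
move=> _ _ [pi cpi <-] [rho crho <-].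
have snd_marginal m (q : probability (Borel X * Borel Z)%type R) :
    couplings m eta q -> forall B, measurable B -> q (setT `*` B) = eta B.
  by move=> [_ h] B mB; rewrite setTX; exact: h.
have [d [W [P [a [b [z [ma mb mz piE rhoE]]]]]]] :=
  gluing hX hX (snd_marginal _ _ cpi) (snd_marginal _ _ crho).
have mab : measurable_fun setT (fun w => (a w, b w)) by exact: measurable_fun_pair.
have [gam gamE] := probability_pushforward P mab.
have cgam : couplings mu nu gam.
  apply: (couplings_law (P := P) (a := a) (b := b)) => [S _|A mA|A mA].
  - exact: gamE.
  - have [<- // _] := cpi; rewrite /pushforward piE// -setXT; exact: measurableX.
  - have [<- // _] := crho; rewrite /pushforward rhoE// -setXT; exact: measurableX.
apply: (le_trans (OT_le _ cgam)).
rewrite (integral_transfer mab (fun S _ => gamE S) mc).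
rewrite -(integral_psiD ma mb mz piE rhoE cpi crho).
apply: ae_le_integral_ext.
- exact: measurableT_comp mab.
- apply: emeasurable_funD; apply: measurableT_comp mpsi _; exact: measurable_fun_pair.
- by apply: aeW => w; rewrite c_inf; apply: ereal_inf_lbound; exists (z w).
Qed.

Lemma factored_le_OT : OT_well_defined mu nu c ->
  ereal_inf [set OT mu eta psi + OT nu eta psi
            | eta in [set: probability (Borel Z) R]] <= OT mu nu c.
Proof.
move=> c_int; apply: le_ereal_inf_tmp => _ [pi cpi <-].
apply/lee_addgt0Pr => eps eps0.
have [e [r [me mr e01 eK]]] := polish_real_retract hZ.
pose x (w : Borel X * Borel X) := w.1; pose y (w : Borel X * Borel X) := w.2.
have mx : measurable_fun setT x by exact: measurable_fst.
have my : measurable_fun setT y by exact: measurable_snd.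
pose f (w : Borel X * Borel X) (z : Borel Z) := psi (w.1, z) + psi (w.2, z).
have mf d (W : measurableType d) (g : W -> Borel X * Borel X) (h : W -> Borel Z) :
    measurable_fun setT g -> measurable_fun setT h ->
    measurable_fun setT (fun w => f (g w) (h w)).
  move=> mg mh; apply: emeasurable_funD; apply: (measurableT_comp mpsi).
    by apply: measurable_fun_pair => //; exact: measurableT_comp mg.
  by apply: measurable_fun_pair => //; exact: measurableT_comp mg.
(* The eps-minimizers, parametrized by the real line. *)
pose B := [set p : (Borel X * Borel X) * R | f p.1 (r p.2) <= c p.1 + eps%:E].
have mB : measurable B.
  rewrite /B -[X in measurable X]setTI; apply: measurable_lee => //.
    by apply: mf => //; exact: measurableT_comp measurable_snd.
  by apply: emeasurable_funD => //; exact: measurableT_comp measurable_fst.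
have Bne w : exists2 t, `[0%R, 1%R]%classic t & B (w, t).
  have [z wz] : exists z, f w z <= c w + eps%:E.
    have [cy|cy] := eqVneq (c w) +oo.
      by exists point; rewrite cy addye ?leey.
    have finc : c w \is a fin_num by rewrite fin_numE gt_eqF.
    move: finc; rewrite (surjective_pairing w) c_inf => finc.
    have [_ [z _ <-] /ltW lez] := lb_ereal_inf_adherent eps0 finc.
    by exists z.
  exists (e z); first by rewrite /= in_itv /= e01.
  by rewrite /B /= eK.
have [zeta mzeta zetaB] := measurable_selection pi mB Bne.
pose z := r \o zeta.
have mz : measurable_fun setT z by exact: measurableT_comp.
have mxz : measurable_fun setT (fun w => (x w, z w)) by exact: measurable_fun_pair.
have myz : measurable_fun setT (fun w => (y w, z w)) by exact: measurable_fun_pair.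
have [eta etaE] := probability_pushforward pi mz.
have [pi1 pi1E] := probability_pushforward pi mxz.
have [pi2 pi2E] := probability_pushforward pi myz.
have cpi1 : couplings mu eta pi1.
  apply: (couplings_law (P := pi) (a := x) (b := z)) => [S _|A mA|A mA].
  - exact: pi1E.
  - by have [h _] := cpi; exact: h.
  - by rewrite etaE.
have cpi2 : couplings nu eta pi2.
  apply: (couplings_law (P := pi) (a := y) (b := z)) => [S _|A mA|A mA].
  - exact: pi2E.
  - by have [_ h] := cpi; exact: h.
  - by rewrite etaE.
apply: (@le_trans _ _ (OT mu eta psi + OT nu eta psi)).
  by apply: ereal_inf_lbound; exists eta.
apply: (le_trans (leeD (OT_le _ cpi1) (OT_le _ cpi2))).
rewrite -(integral_psiD mx my mz (fun S _ => pi1E S) (fun S _ => pi2E S) cpi1 cpi2).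
have -> : \int[pi]_p c p + eps%:E = \int[pi]_p (c p + eps%:E).
  rewrite integralD_ext//=.
  - congr (_ + _); rewrite integral_cst// [X in _ * X](_ : _ = 1) ?mule1//.
    exact: probability_setT.
  - by move=> w; rewrite ltNyr.
  - exact: (c_int _ cpi).
  - rewrite (eq_integral (cst 0)) ?integral0 ?ltry// => w _.
    by rewrite funenegE /= max_r// lee_fin oppr_le0 ltW.
apply: ae_le_integral_ext.
- exact: (mf _ _ id).
- by apply: emeasurable_funD.
- apply: filterS zetaB => w; exact.
Qed.

End factored_cost.

Theorem lemma3p3 (R : realType) (X : ptopologicalType) (hX : polish R X)
  (c : X * X -> \bar R) (c_gtNy : forall p, -oo < c p)
  (c_lsc : lower_semicontinuous c)
  (Z : ptopologicalType) (hZ : polish R Z)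
  (psi : X * Z -> \bar R) (psi_gtNy : forall p, -oo < psi p)
  (psi_meas : measurable_fun [set: Borel X * Borel Z] psi)
  (psi_lsc : forall x : X, lower_semicontinuous (fun z : Z => psi (x, z)))
  (c_inf : forall x y : X,
     c (x, y) = ereal_inf [set psi (x, z) + psi (y, z) | z in [set: Z]])
  (mu nu : probability (Borel X) R)
  (c_int : OT_well_defined mu nu c)
  (psi_int_mu : forall eta : probability (Borel Z) R,
     OT_well_defined mu eta psi)
  (psi_int_nu : forall eta : probability (Borel Z) R,
     OT_well_defined nu eta psi) :
  OT mu nu c =
  ereal_inf [set OT mu eta psi + OT nu eta psi
            | eta in [set: probability (Borel Z) R]].
Proof.
have mc := measurable_lsc_prod hX c_lsc.
apply/eqP; rewrite eq_le; apply/andP; split.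
  by apply: le_ereal_inf_tmp => _ [eta _ <-]; exact: OT_le_factored.
exact: factored_le_OT.
Qed.
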